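(* There exist absolute constants $K>0$ and $C>0$ such that the following holds. Let $a$ be any nonzero integer, and let $s=1$ if $a$ is even and $s=2$ if $a$ is odd. Let $\mathcal{E}$ be any nonempty set of primes. Then for all real $x\ge 2|a|$ and all positive integers $k$, \[ \#\Big\{ p \text{ prime} : -a<p\le x,\ s\mid p+a,\ \frac{p+a}{s}\in\mathcal{Q}(\mathcal{E}),\ \omega\Big(\frac{p+a}{s}\Big)=k\Big\} \le K\,\frac{|a|}{\phi(|a|)}\,\pi(x)\,\frac{(E(x)+C)^{k-1}}{(k-1)!\,\log x}. \]
   Context: $\omega(n)$ denotes the number of distinct prime factors of the positive integer $n$, $\phi$ is Euler's totient function, and $\pi(x)$ is the number of primes $\le x$. For a set $\mathcal{E}$ of primes, $\mathcal{Q}(\mathcal{E})$ is the set of positive integers all of whose prime factors belong to $\mathcal{E}$ (so $1\in\mathcal{Q}(\mathcal{E})$), and $E(x)=\sum_{p\in\mathcal{E},\,p\le x}\frac1p$. The convention $0^0=1$ is used. *)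

(* Defs.v *)
From HB Require Import structures.
From mathcomp Require Import all_boot all_order all_algebra.
From mathcomp Require Import all_classical all_reals all_analysis.
Set Implicit Arguments.
Unset Strict Implicit.
Unset Printing Implicit Defensive.
Import Order.TTheory GRing.Theory Num.Theory.
Local Open Scope classical_set_scope.
Local Open Scope ring_scope.

Definition primes_upto (R : realType) (x : R) : seq nat :=
  [seq p <- iota 0 (Num.truncn x).+1 | prime p].

Lemma primes_upto_uniq (R : realType) (x : R) : uniq (primes_upto x).
Proof. by rewrite filter_uniq ?iota_uniq. Qed.

Lemma mem_primes_upto (R : realType) (x : R) (p : nat) :
  (p \in primes_upto x) = prime p && (p%:R <= x).
Proof.
rewrite mem_filter mem_iota /= add0n ltnS; case pp: (prime p) => //=.
have [x0|x0] := leP 0 x; first by rewrite truncn_ge_nat.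
rewrite (lt_geF (lt_le_trans x0 (ler0n R p))).
have -> : Num.truncn x = 0%N.
  by apply/truncn0Pn; rewrite -ltNge (lt_trans x0 ltr01).
by rewrite leqNgt prime_gt0.
Qed.

Definition prime_pi (R : realType) (x : R) : nat := size (primes_upto x).

Definition recip_prime_sum (R : realType) (E : set nat) (x : R) : R :=
  \sum_(p <- primes_upto x | `[< E p >]) (p%:R)^-1.

Definition omega (n : nat) : nat := size (primes n).

Definition Qset (E : set nat) : set nat :=
  [set n | (0 < n)%N /\ forall q : nat, prime q -> (q %| n)%N -> E q].

Definition shift_s (a : int) : nat := if (2 %| a)%Z then 1 else 2.

(* The absolute value only casts the quotient to nat: it is positive when
   - a < p and s divides p + a, the only case in which it is used. *)
Definition shifted_quot (a : int) (p : nat) : nat :=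
  `|((p%:Z + a) %/ (shift_s a)%:Z)%Z|%N.

Definition shifted_prime (a : int) (E : set nat) (k : nat) : set nat :=
  [set p | [/\ prime p, - a < p%:Z, ((shift_s a)%:Z %| p%:Z + a)%Z,
               Qset E (shifted_quot a p) & omega (shifted_quot a p) = k]].

Definition shifted_prime_count (R : realType) (a : int) (E : set nat)
    (k : nat) (x : R) : nat :=
  count (fun p => `[< shifted_prime a E k p >]) (primes_upto x).

(* Main.v *)
Require Import Defs.
From HB Require Import structures.
From mathcomp Require Import all_boot all_order all_algebra.
From mathcomp Require Import all_classical all_reals all_analysis.
From mathcomp Require Import ring lra zify.
(* Again, so that set0, setP, subsetP and the like refer to finite sets. *)
From mathcomp Require Import fintype finset.
Set Implicit Arguments.
Unset Strict Implicit.
Unset Printing Implicit Defensive.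
Import Order.TTheory GRing.Theory Num.Theory.
Local Open Scope ring_scope.

(** Write a counted prime as p = s n - a, let q be the largest prime factor of
    n, let Q be the full power of q dividing n, and put n = m Q.  The cofactor
    m has k - 1 prime factors, all in E and below q, and p is recovered from
    the pair (m, Q).  So the count is at most the sum over m of the number of
    prime powers Q <= T = N / (s m) with s m Q - a prime, where N is the
    integer part of x plus |a|.

    For fixed m this is a twin-prime type count.  The sieve removes, modulo
    each prime l <= z, the class 0 and the class of a / (s m), which are two
    distinct classes unless l divides s m |a|.  Selberg's sieve, in a form
    where the remainder is bounded trivially (selberg_sieve,
    sieve_mass_lower), gives a constant times rho(s m |a|) T / (ln T)^2, where
    rho(n) = n / phi(n) (prime_pair_bound).  The factor s makes s m |a| even,
    so that the prime 2 loses one class only and a class always survives.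

    What is wanted is (ln N)^2 in place of (ln T)^2.  When a Q exists, T
    is at least the largest prime factor P of m, so that ln N / ln T is at most
    3 + ln m / ln P (ln_ratio_le bounds this a little more crudely).  It
    remains to bound the sum over m of 1 / phi(m) times the square of this
    ratio.  Grouping the m by their set U of prime factors, this becomes a sum
    over the sets U of k - 1 primes of E of a product of weights
    H(p) = 1/p + O(1/p^2), times the square of the sum over p in U of
    ln p / ln P.  The sum over p < P of H(p) ln p is O(ln P), so each factor
    ln p / ln P lets the prime p be removed from U at a bounded cost
    (log_excess_step).  This leaves elementary symmetric sums e_j(H) with
    j = k - 1, k - 2, k - 3, and e_j(H) <= B^j / j! with B the total weight,
    which is at most E(x) + 23.  Losing a prime loses a factor of j, but
    B^j / j! <= (B + 1)^(j+1) / (j+1)!, so the loss is absorbed by enlarging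
    the additive constant C (exp_fact_shift, log_excess_sum).

    Finally N is at most 3x/2, and pi(x) >= c x / ln x by the size of the
    central binomial coefficient (prime_pi_lower). *)

(** * Sums over residues modulo primes *)

Lemma ler_sum_inj (R : numDomainType) (I J : finType) (A : {set I})
    (B : {set J}) (f : I -> J) (F : J -> R) :
  {in A &, injective f} -> (forall i, i \in A -> f i \in B) ->
  (forall j, 0 <= F j) ->
  \sum_(i in A) F (f i) <= \sum_(j in B) F j.
Proof.
move=> finj fAB F0.
rewrite -(big_imset F finj) [leRHS](big_setID (f @: A)) /=.
have -> : B :&: f @: A = f @: A.
  by apply/setIidPr/subsetP=> j /imsetP[i iA ->]; exact: fAB.
by rewrite lerDl sumr_ge0.
Qed.

Lemma sum_Fp (V : nmodType) (p : nat) (w : 'F_p -> V) : prime p ->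
  \sum_(0 <= i < p) w i%:R = \sum_(x : 'F_p) w x.
Proof.
move=> pp; rewrite -[X in \sum_(0 <= i < X) _](Fp_cast pp) big_mkord.
by apply: eq_bigr => x _; rewrite natr_Zp.
Qed.

Lemma sum_Fp_affine (V : nmodType) (p M j : nat) (w : 'F_p -> V) :
  prime p -> ~~ (p %| M)%N ->
  \sum_(0 <= i < p) w (j + i * M)%:R = \sum_(x : 'F_p) w x.
Proof.
move=> pp pM; have M0 : (M%:R : 'F_p) != 0 by rewrite -(dvdn_pcharf (pchar_Fp pp)).
transitivity (\sum_(0 <= i < p) (fun x : 'F_p => w (j%:R + x * M%:R)) i%:R).
  by apply: eq_bigr => i _ /=; rewrite natrD natrM.
rewrite (sum_Fp (fun x : 'F_p => w (j%:R + x * M%:R)) pp).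
rewrite [RHS](reindex (fun x : 'F_p => j%:R + x * M%:R)) //.
exists (fun x => (x - j%:R) / M%:R) => x _; first by rewrite addrC addKr mulfK.
by rewrite mulfVK // addrC subrK.
Qed.

Lemma prime_dvd_prod (I : eqType) (l : seq I) (f : I -> nat) (p : nat) :
  prime p -> (p %| (\prod_(i <- l) f i)%N)%N = has (fun i => p %| f i)%N l.
Proof.
move=> pp; elim: l => [|i l IH]; first by rewrite big_nil dvdn1; case: p pp => [|[]].
by rewrite big_cons Euclid_dvdM //= IH.
Qed.

(** The Chinese remainder theorem in the form needed for averages: with p a
    new prime and M the product of the others, write n = j + i M.  The factors
    at the other primes see j only, and for fixed j the residue of n modulo p
    runs over all of F_p. *)
Lemma sum_prod_Fp (R : comNzRingType) (l : seq nat) (w : forall p, 'F_p -> R) :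
  uniq l -> all prime l ->
  \sum_(0 <= n < (\prod_(p <- l) p)%N) \prod_(p <- l) w p n%:R =
  \prod_(p <- l) \sum_(x : 'F_p) w p x.
Proof.
elim: l => [_ _|p l IH /= /andP[pl ul] /andP[pp al]].
  by rewrite !big_nil big_nat1 big_nil.
rewrite !big_cons; set M := (\prod_(j <- l) j)%N.
have pM : ~~ (p %| M)%N.
  rewrite prime_dvd_prod //; apply/hasPn => q ql.
  rewrite dvdn_prime2 //; last exact: (allP al).
  by apply/eqP => pq; rewrite pq ql in pl.
rewrite big_nat_mul -(IH ul al) -/M.
under eq_bigr => i _.
  rewrite mulSn -{1}[(i * M)%N]add0n big_addn addnK.
  over.
rewrite exchange_big_nat /=.
rewrite mulr_sumr; apply: eq_bigr => j _.
rewrite -(sum_Fp_affine j (w p) pp pM) mulr_suml.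
apply: eq_bigr => i _; rewrite big_cons; congr (_ * _).
rewrite !big_seq; apply: eq_bigr => q ql; congr (w q _).
have pq : prime q by exact: (allP al).
rewrite natrD natrM (_ : M%:R = 0) ?mulr0 ?addr0 //.
apply/eqP; rewrite -(dvdn_pcharf (pchar_Fp pq)) prime_dvd_prod //.
by apply/hasP; exists q.
Qed.

Lemma periodic_sum_le (R : realFieldType) (F : nat -> R) (M T : nat) (B : R) :
  (0 < M)%N -> (forall n, F (n + M)%N = F n) -> (forall n, `|F n| <= B) ->
  \sum_(0 <= n < T) F n <=
  (T %/ M)%:R * (\sum_(0 <= n < M) F n) + M%:R * B.
Proof.
move=> M0 per bF.
have perk i n : F (n + i * M)%N = F n.
  by elim: i => [|i IH]; rewrite ?addn0 // mulSnr addnA per.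
rewrite {1}(divn_eq T M) (@big_cat_nat _ _ _ (T %/ M * M)%N) ?leq_addr //=.
apply: lerD.
  rewrite big_nat_mul.
  under eq_bigr => i _.
    rewrite mulSn -{1}[(i * M)%N]add0n big_addn addnK.
    under eq_bigr => j _ do rewrite perk.
    over.
  by rewrite sumr_const_nat subn0 mulr_natl.
rewrite -{1}[(T %/ M * M)%N]add0n big_addn addKn.
apply: (@le_trans _ _ (\sum_(0 <= i < T %% M) B)).
  by apply: ler_sum => i _; exact: le_trans (ler_norm _) (bF _).
rewrite sumr_const_nat subn0 -[B *+ _]mulr_natl ler_wpM2r //.
  exact: le_trans (normr_ge0 _) (bF 0%N).
by rewrite ler_nat ltnW // ltn_mod.
Qed.

(** * Selberg's upper bound sieve *)

Section Selberg.
Variables (R : realFieldType) (z : nat) (Om : forall p : nat, {set 'F_p}).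

Definition sieve_density (p : nat) : R :=
  #|Om p|%:R / (p%:R - #|Om p|%:R).

(** Square-free moduli up to z, each encoded by its set of prime factors, so
    that products over the primes of a modulus are products over a set. *)
Definition sieve_sets : {set {set 'I_z.+1}} :=
  [set V : {set 'I_z.+1} |
    [forall p in V, prime p] && ((\prod_(p in V) (p : nat))%N <= z)%N].

Definition sieve_mass : R :=
  \sum_(V in sieve_sets) \prod_(p in V) sieve_density p.

Definition sifted (n : nat) : bool :=
  [forall p : 'I_z.+1, prime p ==> (n%:R \notin Om p)].

(** For a modulus V, the function n |-> prod_(p in V) balanced p (n mod p) is
    constant, equal to prod_(p in V) sieve_density p, on sifted integers.  The
    value -1 on the removed classes is what makes the mean over F_p vanish, so
    these functions are orthogonal for the uniform density. *)
Definition balanced (p : nat) (x : 'F_p) : R :=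
  if x \in Om p then -1 else sieve_density p.

Hypothesis Omlt : forall p, prime p -> (p <= z)%N -> (#|Om p| < p)%N.

Local Notation h := sieve_density.

Lemma sieve_densityE p : prime p -> (p <= z)%N ->
  h p * (p%:R - #|Om p|%:R) = #|Om p|%:R.
Proof.
move=> pp pz; rewrite /h mulfVK // subr_eq0 eqr_nat.
by rewrite gtn_eqF // Omlt.
Qed.

Lemma sieve_density_ge0 p : prime p -> (p <= z)%N -> 0 <= h p.
Proof.
move=> pp pz; rewrite divr_ge0 ?ler0n // subr_ge0 ler_nat ltnW //.
exact: Omlt.
Qed.

Lemma sum_if_Om p (a b : R) : prime p ->
  \sum_(x : 'F_p) (if x \in Om p then a else b) =
  #|Om p|%:R * a + (p%:R - #|Om p|%:R) * b.
Proof.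
move=> pp; rewrite (bigID (fun x => x \in Om p)) /=; congr (_ + _).
  rewrite (eq_bigr (fun=> a)); last by move=> i ->.
  by rewrite sumr_const mulr_natl.
rewrite (eq_bigr (fun=> b)); last by move=> i /negbTE ->.
rewrite sumr_const -[b *+ _]mulr_natl; congr (_ * _).
have e : (#|Om p| + #|[predC Om p]| = p)%N by rewrite cardC card_Fp.
apply/eqP; rewrite eq_sym subr_eq -natrD eqr_nat addnC; apply/eqP.
by rewrite -[LHS]e.
Qed.

Lemma sum_balanced p : prime p -> (p <= z)%N ->
  \sum_(x : 'F_p) balanced x = 0.
Proof.
move=> pp pz; rewrite sum_if_Om //.
by rewrite [X in _ + X]mulrC sieve_densityE // mulrN1 addNr.
Qed.

Lemma sum_balanced2 p : prime p -> (p <= z)%N ->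
  \sum_(x : 'F_p) balanced x * balanced x = p%:R * h p.
Proof.
move=> pp pz.
rewrite (eq_bigr (fun x => if x \in Om p then 1 else h p * h p)); last first.
  by move=> x _; rewrite /balanced; case: ifP; rewrite ?mulrNN ?mulr1.
rewrite sum_if_Om //; have := sieve_densityE pp pz.
move: (#|Om p|%:R) (h p) => w g e.
rewrite mulrA [X in _ + X * _]mulrC e mulr1.
by rewrite -{1}e; ring.
Qed.

Lemma norm_balanced p (x : 'F_p) : prime p -> (p <= z)%N ->
  `|balanced x| <= p%:R.
Proof.
move=> pp pz; have p1 : 1 <= p%:R :> R by rewrite ler1n prime_gt0.
rewrite /balanced; case: ifP => _; first by rewrite normrN1.
rewrite ger0_norm ?sieve_density_ge0 //.
have wp := Omlt pp pz.
rewrite /h ler_pdivrMr ?subr_gt0 ?ltr_nat //.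
have : (#|Om p| + 1)%:R <= p%:R :> R by rewrite ler_nat addn1.
rewrite natrD => ?.
have : 0 <= #|Om p|%:R :> R by [].
nra.
Qed.

Lemma sieve_setsP (V : {set 'I_z.+1}) : V \in sieve_sets ->
  (forall p, p \in V -> prime p) /\ ((\prod_(p in V) (p : nat))%N <= z)%N.
Proof.
by rewrite inE => /andP[/forall_inP].
Qed.

(** A set of primes is determined by its product. *)
Lemma card_sieve_sets : (0 < z)%N -> (#|sieve_sets| <= z)%N.
Proof.
move=> z0; pose f (V : {set 'I_z.+1}) : 'I_z.+1 := inord (\prod_(p in V) (p : nat)).
have finj : {in sieve_sets &, injective f}.
  move=> V W /sieve_setsP[Vp Vz] /sieve_setsP[Wp Wz] /(congr1 val) /=.
  rewrite !inordK ?ltnS // => e; apply/setP => q.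
  have key (U : {set 'I_z.+1}) : (forall p, p \in U -> prime p) ->
      prime q -> (q \in U) = (q %| (\prod_(p in U) (p : nat)))%N.
    move=> Up pq; rewrite -big_enum prime_dvd_prod //=.
    apply/idP/hasP => [qU|[p]].
      by exists q; rewrite ?mem_enum.
    rewrite mem_enum => pU; rewrite dvdn_prime2 ?(Up _ pU) // => /eqP/val_inj.
    by move=> ->.
  case pq : (prime q); first by rewrite !key // e.
  by apply/idP/idP => [/Vp|/Wp]; rewrite pq.
rewrite -(card_in_imset finj) -[X in (_ <= X)%N](_ : #|[set~ (ord0 : 'I_z.+1)]| = z).
  apply/subset_leq_card/subsetP => _ /imsetP[V /sieve_setsP[Vp Vz] ->].
  rewrite !inE -val_eqE /= inordK ?ltnS // -lt0n.
  by apply: prodn_cond_gt0 => p /Vp/prime_gt0.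
by rewrite cardsC1 card_ord.
Qed.

Lemma sieve_mass_ge1 : (0 < z)%N -> 1 <= sieve_mass.
Proof.
move=> z0; rewrite /sieve_mass (bigD1 (set0 : {set 'I_z.+1})) /=; last first.
  by rewrite inE big_set0 z0 andbT; apply/forall_inP => p; rewrite inE.
rewrite big_set0 lerDl; apply: sumr_ge0 => V /andP[/sieve_setsP[Vp _] _].
by apply: prodr_ge0 => p pV; rewrite sieve_density_ge0 ?Vp // -ltnS.
Qed.

Definition balanced_prod (V : {set 'I_z.+1}) (n : nat) : R :=
  \prod_(p in V) balanced (n%:R : 'F_p).

(** Over a full period the product has mean 0 unless V = W, in which case the
    mean is prod_(p in V) sieve_density p.  The incomplete last period costs at
    most (length of the period) * (sup of the product) <= z^2 * z^2. *)
Lemma sum_balanced_prod V W T : V \in sieve_sets -> W \in sieve_sets ->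
  \sum_(0 <= n < T) balanced_prod V n * balanced_prod W n <=
  (if V == W then T%:R * \prod_(p in V) h p else 0) + z%:R ^+ 4.
Proof.
move=> /sieve_setsP[Vp Vz] /sieve_setsP[Wp Wz].
have pU (p : 'I_z.+1) : p \in V :|: W -> prime p.
  by rewrite inE => /orP[/Vp|/Wp].
have lez (p : 'I_z.+1) : (p <= z)%N by rewrite -ltnS.
pose w p (x : 'F_p) : R := (if inord p \in V then balanced x else 1) *
                           (if inord p \in W then balanced x else 1).
pose F n := \prod_(p in V :|: W) w p (n%:R).
have FE n : balanced_prod V n * balanced_prod W n = F n.
  rewrite /F /balanced_prod.
  rewrite (big_mkcond (mem V)) (big_mkcond (mem W)) (big_mkcond (mem (V :|: W))).
  rewrite -big_split; apply: eq_bigr => p _ /=; rewrite /w inord_val inE.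
  by case: (p \in V); case: (p \in W); rewrite /= ?mulr1.
pose l := [seq val p | p <- enum (V :|: W)].
pose M := (\prod_(p <- l) p)%N.
have ul : uniq l by rewrite map_inj_uniq ?enum_uniq //; exact: val_inj.
have al : all prime l.
  by apply/allP => q /mapP[p]; rewrite mem_enum => /pU pp ->.
have FlE n : F n = \prod_(p <- l) w p n%:R by rewrite big_map big_enum.
have ME : M = (\prod_(p in V :|: W) (p : nat))%N by rewrite /M big_map big_enum.
have M0 : (0 < M)%N.
  by rewrite ME; apply: prodn_cond_gt0 => p /pU/prime_gt0.
have Mz : (M <= z * z)%N.
  apply: leq_trans (leq_mul Vz Wz); rewrite ME.
  rewrite (big_mkcond (mem V)) (big_mkcond (mem W)) (big_mkcond (mem (V :|: W))).
  rewrite -big_split; apply: leq_prod => p _ /=; rewrite inE.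
  have p0 : p \in V -> (0 < p)%N by move/Vp/prime_gt0.
  case: (p \in V) p0; case: (p \in W); rewrite /= ?muln1 ?mul1n // => /(_ isT) p0.
  by rewrite leq_pmulr.
have per n : F (n + M)%N = F n.
  rewrite !FlE !big_seq; apply: eq_bigr => q ql; congr (w q _).
  have pq : prime q by exact: (allP al).
  rewrite natrD (_ : M%:R = 0) ?addr0 //.
  apply/eqP; rewrite -(dvdn_pcharf (pchar_Fp pq)) prime_dvd_prod //.
  by apply/hasP; exists q.
have bV (U : {set 'I_z.+1}) n : (forall p, p \in U -> prime p) ->
   ((\prod_(p in U) (p : nat))%N <= z)%N -> `|balanced_prod U n| <= z%:R.
  move=> Up Uz; rewrite normr_prod.
  apply: (@le_trans _ _ (\prod_(p in U) (p : nat)%:R)).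
    by apply: ler_prod => p /Up pp; rewrite normr_ge0 norm_balanced.
  by rewrite -natr_prod ler_nat.
have bF n : `|F n| <= z%:R ^+ 2.
  by rewrite -FE normrM expr2 ler_pM // bV.
rewrite (eq_bigr F) //.
apply: le_trans (periodic_sum_le T M0 per bF) _.
apply: lerD; last first.
  rewrite (_ : 4 = 2 + 2)%N // exprD ler_wpM2r ?exprn_ge0 //.
  by rewrite expr2 -natrM ler_nat.
rewrite (eq_bigr _ (fun n _ => FlE n)) sum_prod_Fp // big_map big_enum /=.
case: eqP => [VW|/eqP VW].
  rewrite (eq_bigr (fun p : 'I_z.+1 => (p : nat)%:R * h p)); last first.
    move=> p; rewrite inE -VW orbb => pV; apply: etrans (sum_balanced2 (Vp p pV) (lez p)).
    by apply: eq_bigr => x _; rewrite /w inord_val -VW pV.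
  rewrite big_split /= -natr_prod -ME -VW setUid mulrA ler_wpM2r //.
    by apply: prodr_ge0 => p pV; rewrite sieve_density_ge0 ?Vp.
  by rewrite -natrM ler_nat leq_divM.
have [q qVW qx] : exists2 q, q \in V :|: W & (q \in V) != (q \in W).
  have /subsetPn[q qA qB] : ~~ ((V :|: W) \subset (V :&: W)).
    apply: contraNN VW => /subsetP sub; apply/eqP/setP => q; apply/idP/idP => qq.
      by have := sub q; rewrite !inE qq => /(_ isT)/andP[].
    by have := sub q; rewrite !inE qq orbT => /(_ isT)/andP[].
  exists q => //; move: qA qB; rewrite !inE.
  by case: (q \in V); case: (q \in W).
have wq : \sum_(x : 'F_q) w q x = 0.
  apply: etrans (sum_balanced (pU q qVW) (lez q)); apply: eq_bigr => x _.
  rewrite /w inord_val; move: qx.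
  by case: (q \in V); case: (q \in W); rewrite ?mulr1 ?mul1r.
by rewrite (bigD1 q) //= wq mul0r mulr0.
Qed.

(** Put f = sum_V balanced_prod V / sieve_mass.  Then f = 1 on sifted integers,
    so their number is at most the sum of f^2, whose diagonal terms give
    T / sieve_mass.  This f is Selberg's optimal weight written in the
    orthogonal basis instead of the basis of indicators of the removed
    classes; no formula for the classical weights lambda_d is then needed.
    The crude remainder z^6 suffices because z will be a small power of T. *)
Theorem selberg_sieve (T : nat) : (0 < z)%N ->
  \sum_(0 <= n < T | sifted n) 1 <= T%:R / sieve_mass + z%:R ^+ 6.
Proof.
move=> z0; have G1 := sieve_mass_ge1 z0.
have G0 : 0 < sieve_mass by exact: lt_le_trans ltr01 G1.
pose f n := \sum_(V in sieve_sets) balanced_prod V n.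
have fG n : sifted n -> f n = sieve_mass.
  move=> /forallP sn; apply: eq_bigr => V /sieve_setsP[Vp _].
  apply: eq_bigr => p /Vp pp; rewrite /balanced.
  by have := sn p; rewrite pp /= => /negbTE ->.
have -> : T%:R / sieve_mass + z%:R ^+ 6 =
   (T%:R * sieve_mass + z%:R ^+ 6 * sieve_mass ^+ 2) / sieve_mass ^+ 2.
  by field; rewrite gt_eqF.
rewrite ler_pdivlMr ?exprn_gt0 // mulr_suml.
apply: (@le_trans _ _ (\sum_(0 <= n < T) f n ^+ 2)).
  rewrite big_mkcond; apply: ler_sum => n _; case: ifP => [/fG ->|_].
    by rewrite mul1r.
  exact: sqr_ge0.
have -> : \sum_(0 <= n < T) f n ^+ 2 = \sum_(V in sieve_sets)
    \sum_(W in sieve_sets) \sum_(0 <= n < T) balanced_prod V n * balanced_prod W n.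
  under eq_bigr => n _ do rewrite expr2 mulr_suml.
  rewrite exchange_big; apply: eq_bigr => V _.
  under eq_bigr => n _ do rewrite mulr_sumr.
  by rewrite exchange_big.
apply: (@le_trans _ _ (\sum_(V in sieve_sets)
   (T%:R * \prod_(p in V) h p + z%:R * z%:R ^+ 4))).
  apply: ler_sum => V VS.
  apply: (@le_trans _ _ (\sum_(W in sieve_sets)
     ((if V == W then T%:R * \prod_(p in V) h p else 0) + z%:R ^+ 4))).
    by apply: ler_sum => W WS; exact: sum_balanced_prod.
  rewrite big_split /= (bigD1 V) //= eqxx [X in _ + X + _]big1 ?addr0; last first.
    by move=> W /andP[_]; rewrite eq_sym => /negbTE ->.
  rewrite lerD2l sumr_const -[_ ^+ 4 *+ _]mulr_natl ler_wpM2r ?exprn_ge0 //.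
  by rewrite ler_nat card_sieve_sets.
rewrite big_split /= -mulr_sumr lerD2l sumr_const -[(_ * _) *+ _]mulr_natl.
apply: (@le_trans _ _ (z%:R * (z%:R * z%:R ^+ 4))).
  by rewrite ler_wpM2r ?mulr_ge0 ?exprn_ge0 // ler_nat card_sieve_sets.
have -> : z%:R * (z%:R * z%:R ^+ 4) = z%:R ^+ 6 :> R by ring.
by rewrite ler_peMr ?exprn_ge0 // exprn_ege1.
Qed.

End Selberg.

(** * The lower bound for the sieve mass *)

(** The easy half of an Euler product: expanding the product on the right gives
    one term for each choice of local data, and distinct x make distinct
    choices. *)
Lemma euler_fiber (R : numDomainType) (X I J : finType) (j0 : J)
    (A : {set X}) (U : {set I}) (k : X -> I -> J) (Q : I -> pred J)
    (F : I -> J -> R) :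
  (forall x y, x \in A -> y \in A -> (forall p, p \in U -> k x p = k y p) ->
     x = y) ->
  (forall x p, x \in A -> p \in U -> Q p (k x p)) ->
  (forall p j, 0 <= F p j) ->
  \sum_(x in A) \prod_(p in U) F p (k x p) <=
  \prod_(p in U) \sum_(j | Q p j) F p j.
Proof.
move=> kinj kQ F0; rewrite (big_distr_big_dep j0).
pose f x := [ffun p => if p \in U then k x p else j0].
rewrite (eq_bigr (fun x => (fun g : {ffun I -> J} =>
   \prod_(p in U) F p (g p)) (f x))); last first.
  by move=> x xA; apply: eq_bigr => p pU; rewrite ffunE pU.
rewrite -[leRHS](eq_bigl _ _ (fun g => in_set (fun g => g \in pfamily j0 (mem U) Q) g)).
apply: ler_sum_inj.
- move=> x y xA yA /ffunP e; apply: kinj => // p pU.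
  by have := e p; rewrite !ffunE pU.
- move=> x xA; rewrite inE; apply/pfamilyP; split=> [|p pU].
    by apply/subsetP => p; rewrite !inE ffunE; case: ifP => //; rewrite eqxx.
  by rewrite ffunE pU; exact: kQ.
- by move=> g; apply: prodr_ge0.
Qed.

Lemma prod_logn_ord (z u : nat) : (0 < u)%N -> (u <= z)%N ->
  u = (\prod_(p < z.+1 | prime p) p ^ logn p u)%N.
Proof.
move=> u0 uz; rewrite -[LHS](partnT u0) (widen_partn _ uz) big_mkord.
rewrite [RHS]big_mkcond /=; apply: eq_bigr => p _.
by case: ifP => // /negbT pp; rewrite lognE (negbTE pp).
Qed.

Lemma eq_logn_ord (z u v : nat) : (0 < u)%N -> (u <= z)%N ->
  (0 < v)%N -> (v <= z)%N ->
  (forall p : 'I_z.+1, prime p -> logn p u = logn p v) -> u = v.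
Proof.
move=> u0 uz v0 vz e; rewrite (prod_logn_ord u0 uz) (prod_logn_ord v0 vz).
by apply: eq_bigr => p /e ->.
Qed.

Lemma dvdn_prod_primes (l : seq nat) (n : nat) : uniq l -> all prime l ->
  all (fun p => p %| n)%N l -> ((\prod_(p <- l) p)%N %| n)%N.
Proof.
elim: l => [|p l IH] /=; first by rewrite big_nil dvd1n.
move=> /andP[pl ul] /andP[pp al] /andP[pn ln]; rewrite big_cons Gauss_dvd ?pn ?IH //.
rewrite prime_coprime // prime_dvd_prod //; apply/hasPn => q ql.
rewrite dvdn_prime2 //; last exact: (allP al).
by apply/eqP => pq; rewrite pq ql in pl.
Qed.

(** This is n / phi(n) for n > 0, see rho_totient. *)
Definition rho (R : fieldType) (n : nat) : R :=
  \prod_(p <- primes n) (p%:R / (p%:R - 1)).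

Lemma geom_sum_le (R : realFieldType) (r : R) (n : nat) : 0 <= r -> r < 1 ->
  \sum_(i < n) r ^+ i <= (1 - r)^-1.
Proof.
move=> r0 r1; rewrite -[_^-1]mul1r ler_pdivlMr ?subr_gt0 //.
have := subrX1 r n; have : 0 <= r ^+ n by apply: exprn_ge0.
by move: (r ^+ n) => t; nra.
Qed.

(** Sums over the pairs (i, j) of exponents of a prime p in a pair of integers.
    The four bounds are the local factors of sieve_mass_lower, according to
    whether p divides D and whether p belongs to the set of the fiber. *)
Section LocalFactors.
Variables (R : realFieldType) (y p : nat).
Hypothesis pp : prime p.
Local Notation r := ((p%:R : R)^-1).
Local Notation J := ('I_y.+1 * 'I_y.+1)%type.

Let p2 : 2 <= p%:R :> R. Proof. by rewrite (ler_nat R 2) prime_gt1. Qed.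

Let g : R := \sum_(i < y.+1) r ^+ i.

Let gle : g <= p%:R / (p%:R - 1).
Proof.
have -> : p%:R / (p%:R - 1) = (1 - r)^-1.
  by have := p2 => ?; field; apply/andP; split; lra.
have := p2 => ?; apply: geom_sum_le; rewrite ?invr_ge0 ?ler0n //.
by rewrite invf_lt1; lra.
Qed.

Let gE : g = 1 + \sum_(i < y) r ^+ i.+1.
Proof. by rewrite /g big_ord_recl expr0; congr (_ + _). Qed.

Lemma local_sum0 : \sum_(j : J | (j.1 == ord0) && (j.2 == ord0)) r ^+ (j.1 + j.2) = 1.
Proof.
rewrite (big_pred1 (ord0, ord0)); first by rewrite expr0.
by move=> [a b]; rewrite /= xpair_eqE.
Qed.

Lemma local_sumT : \sum_(j : J) r ^+ (j.1 + j.2) = g * g.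
Proof.
rewrite -(pair_bigA _ (fun i j : 'I_y.+1 => r ^+ (i + j))) /= /g mulr_suml.
apply: eq_bigr => i _; rewrite mulr_sumr; apply: eq_bigr => j _.
by rewrite exprD.
Qed.

Lemma local_sum1 : \sum_(j : J | j.2 == ord0) r ^+ (j.1 + j.2) = g.
Proof.
rewrite -(pair_big xpredT (fun b : 'I_y.+1 => b == ord0)
   (fun i j : 'I_y.+1 => r ^+ (i + j))) /=.
by apply: eq_bigr => i _; rewrite big_pred1_eq addn0.
Qed.

Lemma local_undivided :
  \sum_(j : J | ~~ ((0 < j.2) || (0 < j.1))%N) r ^+ (j.1 + j.2) <= 1.
Proof.
rewrite -[leRHS]local_sum0; rewrite le_eqVlt; apply/orP; left; apply/eqP.
apply: eq_bigl => j; rewrite negb_or -!eqn0Ngt andbC -!val_eqE //.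
Qed.

Lemma local_undivided_dvd :
  \sum_(j : J | ~~ (0 < j.2)%N) r ^+ (j.1 + j.2) <= p%:R / (p%:R - 1).
Proof.
rewrite (eq_bigl (fun j : J => j.2 == ord0)) ?local_sum1 //.
by move=> j; rewrite -eqn0Ngt.
Qed.

Lemma local_divided_dvd :
  \sum_(j : J | (0 < j.2)%N) r ^+ (j.1 + j.2) <=
  p%:R / (p%:R - 1) * (p%:R - 1)^-1.
Proof.
have e : \sum_(j : J | (0 < j.2)%N) r ^+ (j.1 + j.2) = g * g - g.
  rewrite -local_sumT -[X in _ - X]local_sum1 [X in X - _](bigID (fun j : J => j.2 == ord0)) /=.
  rewrite addrAC subrr add0r; apply: eq_bigl => j.
  by rewrite -val_eqE /= lt0n.
rewrite e (_ : g * g - g = g * (g - 1)); last by ring.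
have := gle; have := p2 => h2 hg.
have g1 : 1 <= g.
  by rewrite gE lerDl; apply: sumr_ge0 => i _; rewrite exprn_ge0 // invr_ge0.
apply: ler_pM => //; try lra.
have -> : (p%:R - 1)^-1 = p%:R / (p%:R - 1) - 1 :> R by field; lra.
lra.
Qed.

Lemma local_divided : (2 < p)%N ->
  \sum_(j : J | ((0 < j.2) || (0 < j.1))%N) r ^+ (j.1 + j.2) <=
  2 / (p%:R - 2).
Proof.
move=> p3; have {}p3 : 3 <= p%:R :> R by rewrite (ler_nat R 3).
have e : \sum_(j : J | ((0 < j.2) || (0 < j.1))%N) r ^+ (j.1 + j.2) = g * g - 1.
  rewrite -local_sumT -[X in _ - X]local_sum0.
  rewrite [X in X - _](bigID (fun j : J => (j.1 == ord0) && (j.2 == ord0))) /=.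
  rewrite addrAC subrr add0r; apply: eq_bigl => j.
  by rewrite -!val_eqE /= negb_and !lt0n orbC.
rewrite e; have hg := gle.
have g1 : 1 <= g.
  by rewrite gE lerDl; apply: sumr_ge0 => i _; rewrite exprn_ge0 // invr_ge0.
have : g * g <= (p%:R / (p%:R - 1)) ^+ 2 by rewrite expr2 ler_pM //; lra.
suff : (p%:R / (p%:R - 1)) ^+ 2 - 1 <= 2 / (p%:R - 2) :> R by lra.
rewrite -subr_ge0 (_ : _ - _ = p%:R / ((p%:R - 2) * (p%:R - 1) ^+ 2)).
  by rewrite divr_ge0 // mulr_ge0 ?exprn_ge0 //; lra.
by field; apply/andP; split; lra.
Qed.

End LocalFactors.

Lemma rho_factor_ge1 (R : realFieldType) (p : nat) : prime p ->
  1 <= p%:R / (p%:R - 1) :> R.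
Proof.
move=> pp; have p2 : 2 <= p%:R :> R by rewrite (ler_nat R 2) prime_gt1.
by rewrite ler_pdivlMr; lra.
Qed.

Lemma rho_ge1 (R : realFieldType) (n : nat) : 1 <= rho R n.
Proof.
rewrite /rho big_seq; apply: (big_ind (fun x => 1 <= x)) => //.
  by move=> x y; exact: mulr_ege1.
by move=> p; rewrite mem_primes => /andP[pp _]; exact: rho_factor_ge1.
Qed.

Lemma prod_primes_le_rho (R : realFieldType) (z D : nat) : (0 < D)%N ->
  \prod_(p < z.+1 | prime p && (p %| D)%N) (p%:R / (p%:R - 1)) <= rho R D.
Proof.
move=> D0; rewrite /rho.
have -> : \prod_(p < z.+1 | prime p && (p %| D)%N) (p%:R / (p%:R - 1)) =
    \prod_(p <- primes D | (p <= z)%N) (p%:R / (p%:R - 1)) :> R.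
  rewrite -(big_mkord (fun p => prime p && (p %| D)%N)
     (fun p : nat => p%:R / (p%:R - 1) : R)) -big_filter -[RHS]big_filter.
  apply: perm_big; apply: uniq_perm; rewrite ?filter_uniq ?primes_uniq ?iota_uniq //.
  move=> p; rewrite !mem_filter mem_primes mem_index_iota D0 ltnS andbC.
  by case: (prime p).
rewrite [leRHS](bigID (fun p => p <= z)%N) /=.
have f0 : forall q, q \in primes D -> 1 <= q%:R / (q%:R - 1) :> R.
  by move=> q; rewrite mem_primes => /andP[qp _]; exact: rho_factor_ge1.
rewrite ler_peMr //.
  rewrite big_seq_cond; apply: prodr_ge0 => q /andP[qD _].
  exact: le_trans ler01 (f0 _ qD).
rewrite big_seq_cond; apply: (big_ind (fun x => 1 <= x)) => //.
  by move=> x1 x2; exact: mulr_ege1.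
by move=> q /andP[/f0].
Qed.

(** Expand the square of the harmonic sum over pairs (u, v), and attach to a
    pair the set V of the primes dividing v or the prime-to-D part of u; the
    product of V divides u v <= z.  The pairs attached to V are bounded by an
    Euler product whose factor at p is p / (p - 1) when p divides D, times
    something at most sieve_density p when p is in V.  For p not dividing D the
    last point is (1 - 1/p)^(-2) - 1 <= 2 / (p - 2). *)
Theorem sieve_mass_lower (R : realFieldType) (z y D : nat)
    (Om : forall p : nat, {set 'F_p}) :
  (y * y <= z)%N -> (0 < D)%N -> (2 %| D)%N ->
  (forall p, prime p -> (p <= z)%N -> #|Om p| = if (p %| D)%N then 1%N else 2) ->
  (\sum_(1 <= u < y.+1) (u%:R)^-1) ^+ 2 <= rho R D * sieve_mass R z Om.
Proof.
move=> yz D0 D2 cOm.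
have yz' : (y <= z)%N by apply: leq_trans yz; case: (y) => // n; rewrite leq_pmulr.
have Omlt q : prime q -> (q <= z)%N -> (#|Om q| < q)%N.
  move=> pq qz; rewrite cOm //; case: ifP => qD; first exact: prime_gt1.
  by rewrite ltn_neqAle prime_gt1 // andbT; apply: contraFneq qD => <-.
pose r (p : nat) : R := (p%:R)^-1.
pose X := ('I_y.+1 * 'I_y.+1)%type.
pose A : {set X} := [set x : X | (0 < x.1)%N && (0 < x.2)%N].
pose dv (p u v : nat) := (p %| v)%N || (~~ (p %| D)%N && (p %| u)%N).
pose V (x : X) : {set 'I_z.+1} := [set p : 'I_z.+1 | prime p && dv p x.1 x.2].
have -> : (\sum_(1 <= u < y.+1) (u%:R)^-1) ^+ 2 =
    \sum_(x in A) (x.1%:R)^-1 * (x.2%:R)^-1 :> R.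
  have -> : \sum_(1 <= u < y.+1) (u%:R)^-1 =
      \sum_(u : 'I_y.+1 | (0 < u)%N) (u%:R)^-1 :> R.
    rewrite (@big_nat_widenl _ _ _ 1 0) // big_mkord.
    by apply: eq_bigl => u.
  rewrite expr2 mulr_suml.
  under eq_bigr do rewrite mulr_sumr.
  by rewrite pair_big /=; apply: eq_bigl => x; rewrite inE.
have ltz (p : 'I_z.+1) : (p <= z)%N by rewrite -ltnS.
have VS x : x \in A -> V x \in sieve_sets z.
  rewrite !inE => /andP[u0 v0]; apply/andP; split.
    by apply/forall_inP => p; rewrite inE => /andP[].
  apply: leq_trans yz.
  apply: (@leq_trans (x.1 * x.2)); last by apply: leq_mul; rewrite -ltnS.
  apply: dvdn_leq; first by rewrite muln_gt0 u0.
  rewrite -big_enum -(big_map val xpredT id) /=; apply: dvdn_prod_primes.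
  - by rewrite map_inj_uniq ?enum_uniq //; exact: val_inj.
  - by apply/allP => q /mapP[p]; rewrite mem_enum inE => /andP[pp _] ->.
  - apply/allP => q /mapP[p]; rewrite mem_enum inE => /andP[pp pd] ->.
    move: pd; rewrite /dv Euclid_dvdM // => /orP[->|/andP[_ ->]] //.
    by rewrite orbT.
rewrite (partition_big V (mem (sieve_sets z))) //= /sieve_mass mulr_sumr.
apply: ler_sum => W /sieve_setsP[Wp Wz].
pose P : {set 'I_z.+1} := [set p : 'I_z.+1 | prime p].
pose k (x : X) (p : 'I_z.+1) : X := (inord (logn p x.1), inord (logn p x.2)).
pose Q (p : 'I_z.+1) : pred X := fun j =>
  (p \in W) == ((0 < j.2)%N || (~~ (p %| D)%N && (0 < j.1)%N)).
pose F (p : 'I_z.+1) (j : X) : R := r p ^+ (j.1 + j.2).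
have lny (p : nat) (u : 'I_y.+1) : (logn p u <= y)%N.
  case: (posnP u) => [->|u0]; first by rewrite logn0.
  by apply: ltnW; apply: leq_trans (ltn_logl p u0) _; rewrite -ltnS.
have FE x : x \in A -> (x.1%:R)^-1 * (x.2%:R)^-1 = \prod_(p in P) F p (k x p).
  rewrite inE => /andP[u0 v0].
  have invE (u : 'I_y.+1) : (0 < u)%N ->
      (u%:R)^-1 = \prod_(p in P) r p ^+ logn p u :> R.
    move=> u0'; have uz : (u <= z)%N by apply: leq_trans yz'; rewrite -ltnS.
    rewrite {1}(prod_logn_ord u0' uz) natr_prod -prodfV.
    by apply: eq_big => [p|p pp]; rewrite ?inE // natrX exprVn.
  rewrite !invE // -big_split; apply: eq_bigr => p _.
  by rewrite /F /k /= !inordK ?ltnS // exprD.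
have -> : \sum_(x in A | V x == W) (x.1%:R)^-1 * (x.2%:R)^-1 =
    \sum_(x in [set x in A | V x == W]) \prod_(p in P) F p (k x p).
  apply: eq_big => [x|x /andP[xA _]]; first by rewrite [RHS]inE.
  exact: FE.
have r0 p : 0 <= r p by rewrite invr_ge0.
have logn_gt0_dvd (p u : nat) : prime p -> (0 < u)%N -> (0 < logn p u)%N = (p %| u)%N.
  by move=> pp u0; rewrite logn_gt0 mem_primes pp u0.
apply: (le_trans (@euler_fiber R X _ X (ord0, ord0) _ P k Q F _ _ _)).
- move=> x x'; rewrite !inE => /andP[/andP[u0 v0] _] /andP[/andP[u0' v0'] _] e.
  have ordy (u : 'I_y.+1) : (u <= z)%N by apply: leq_trans yz'; rewrite -ltnS.
  have e1 (p : 'I_z.+1) : prime p ->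
      logn p x.1 = logn p x'.1 /\ logn p x.2 = logn p x'.2.
    move=> pp; have := e p; rewrite inE => /(_ pp)[].
    by move=> /(congr1 val) + /(congr1 val); rewrite /= !inordK ?ltnS.
  case: x x' u0 v0 u0' v0' e e1 => [u v] [u' v'] /= u0 v0 u0' v0' e e1.
  by congr (_, _); apply: val_inj; apply: (@eq_logn_ord z); rewrite ?ordy // => p /e1[].
- move=> x p; rewrite !inE => /andP[/andP[u0 v0] /eqP VW] pp.
  by rewrite /Q -VW inE pp /= /dv !inordK ?ltnS // !logn_gt0_dvd.
- by move=> p j; rewrite exprn_ge0.
apply: (@le_trans _ _ (\prod_(p in P) ((if (p %| D)%N then p%:R / (p%:R - 1) else 1) *
   (if p \in W then sieve_density R Om p else 1)))).
  apply: ler_prod => p; rewrite inE => pp; apply/andP; split.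
    by apply: sumr_ge0 => j _; rewrite exprn_ge0.
  rewrite /Q /F /sieve_density cOm //.
  case: ifP => pD; case: ifP => pW; rewrite /= ?mulr1 ?mul1r.
  - rewrite (eq_bigl (fun j : X => (0 < j.2)%N));
      last by move=> j; case: (0 < j.2)%N; case: (0 < j.1)%N.
    exact: local_divided_dvd.
  - rewrite (eq_bigl (fun j : X => ~~ (0 < j.2)%N));
      last by move=> j; case: (0 < j.2)%N; case: (0 < j.1)%N.
    exact: local_undivided_dvd.
  - rewrite (eq_bigl (fun j : X => (0 < j.2)%N || (0 < j.1)%N));
      last by move=> j; case: (0 < j.2)%N; case: (0 < j.1)%N.
    apply: local_divided => //.
    rewrite ltn_neqAle prime_gt1 // andbT; apply: contraFneq pD => <- //.
  - rewrite (eq_bigl (fun j : X => ~~ ((0 < j.2)%N || (0 < j.1)%N)));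
      last by move=> j; case: (0 < j.2)%N; case: (0 < j.1)%N.
    exact: local_undivided.
rewrite big_split /= ler_pM //.
- apply: prodr_ge0 => p; rewrite inE => pp; case: ifP => // _.
  exact: le_trans ler01 (rho_factor_ge1 _ pp).
- apply: prodr_ge0 => p; rewrite inE => pp; case: ifP => // pW.
  exact: sieve_density_ge0 Omlt _ pp (ltz p).
- rewrite -big_mkcondr /=; apply: le_trans (prod_primes_le_rho R z D0).
  by rewrite le_eqVlt; apply/orP; left; apply/eqP; apply: eq_bigl => p; rewrite inE.
- rewrite -big_mkcondr le_eqVlt; apply/orP; left; apply/eqP; apply: eq_bigl => p.
  by rewrite !inE; case pW : (p \in W); rewrite ?andbF ?andbT // Wp.
Qed.

(** * Prime powers Q with A Q - a prime *)

Lemma ln_le_harmonic (R : realType) (y : nat) :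
  ln (y.+1%:R) <= \sum_(1 <= u < y.+1) (u%:R)^-1 :> R.
Proof.
elim: y => [|y IH]; first by rewrite big_geq // ln1.
rewrite big_nat_recr //=.
have -> : y.+2%:R = y.+1%:R * (1 + (y.+1%:R)^-1) :> R.
  by rewrite mulrDr mulr1 mulfV ?pnatr_eq0 // -natr1.
have y0 : 0 < (y.+1%:R : R)^-1 by rewrite invr_gt0 ltr0n.
rewrite lnM ?posrE ?ltr0n ?addr_gt0 //; apply: lerD => //; apply: le_ln1Dx.
by apply: lt_trans y0; rewrite ltrN10.
Qed.

(** A prime power Q is counted along with the primes: the sieve only sees the
    prime dividing Q, so the higher powers come at no extra cost. *)
Definition prime_pair (A : nat) (a : int) (Q : nat) : bool :=
  [&& size (primes Q) == 1%N, 0 <= A%:Z * Q%:Z - a & prime `|(A%:Z * Q%:Z - a)%R|%N].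

Lemma primes1P (Q : nat) : size (primes Q) = 1%N ->
  exists q, [/\ prime q, primes Q = [:: q], (0 < logn q Q)%N & Q = (q ^ logn q Q)%N].
Proof.
case E : (primes Q) => [|q [|]] // _; exists q.
have : q \in primes Q by rewrite E inE.
move=> qQ; have := qQ; rewrite mem_primes => /and3P[pq Q0 qdQ]; split=> //.
  by rewrite logn_gt0.
rewrite {1}(prod_prime_decomp Q0) prime_decompE E /=.
by rewrite big_seq1.
Qed.

Section PrimePair.
Variables (R : realType) (A : nat) (a : int) (T : nat).
Hypothesis A0 : (0 < A)%N.

Let D := (A * `|a|)%N.

Definition pair_classes (p : nat) : {set 'F_p} :=
  if (p %| D)%N then [set 0] else [set 0; a%:~R / A%:R].

Lemma Fp_natr_eq0 p n : prime p -> ((n%:R : 'F_p) == 0) = (p %| n)%N.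
Proof. by move=> pp; rewrite -(dvdn_pcharf (pchar_Fp pp)). Qed.

Lemma Fp_intr_eq0 p (b : int) : prime p -> ((b%:~R : 'F_p) == 0) = (p %| `|b|)%N.
Proof.
move=> pp; rewrite -(Fp_natr_eq0 _ pp) {1}(intEsign b) intrM mulf_eq0.
by rewrite rmorph_sign signr_eq0.
Qed.

Lemma card_pair_classes p : prime p ->
  #|pair_classes p| = if (p %| D)%N then 1%N else 2.
Proof.
move=> pp; rewrite /pair_classes; case: ifP => pD; first by rewrite cards1.
rewrite cards2; suff -> : (0 : 'F_p) != a%:~R / A%:R by [].
rewrite eq_sym mulf_neq0 ?invr_eq0 // ?Fp_intr_eq0 ?Fp_natr_eq0 //.
  by apply: contraFN pD => /(dvdn_mull A).
by apply: contraFN pD => /(dvdn_mulr `|a|).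
Qed.

Lemma prime_pair_sifted z Q : prime_pair A a Q ->
  (forall q, primes Q = [:: q] -> (z < q)%N) -> (z < `|(A%:Z * Q%:Z - a)%R|)%N ->
  sifted z pair_classes Q.
Proof.
case/and3P=> /eqP /primes1P[q [pq EQ e0 QE]] ge0 pP qz Pz.
have {}qz := qz _ EQ.
apply/forallP => p; apply/implyP => pp.
have pz : (p <= z)%N by rewrite -ltnS.
have pQ : ~~ (p %| Q)%N.
  rewrite QE Euclid_dvdX // e0 andbT dvdn_prime2 //.
  by apply/eqP => pq'; rewrite pq' leqNgt qz in pz.
rewrite /pair_classes; case: ifP => pD; rewrite !inE Fp_natr_eq0 // (negbTE pQ) //=.
apply/eqP => /(congr1 (fun x => A%:R * x)).
rewrite mulrC [RHS]mulrC mulfVK; last first.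
  rewrite Fp_natr_eq0 //; apply: contraFN pD => /(dvdn_mulr `|a|) //.
move/eqP; rewrite -subr_eq0 mulrC -natrM.
rewrite -[(A * Q)%:R]/((A * Q)%N%:Z%:~R) -rmorphB /= Fp_intr_eq0 // PoszM.
rewrite dvdn_prime2 // => /eqP pE; by rewrite -pE ltnNge pz in Pz.
Qed.

Lemma count_inj_le (n : nat) (P : pred nat) (J : finType) (f : nat -> J) :
  (forall i j, P i -> P j -> f i = f j -> i = j) ->
  \sum_(0 <= i < n | P i) 1 <= #|J|%:R :> R.
Proof.
move=> finj; rewrite big_mkord sumr_const ler_nat.
have inj : {in [pred i : 'I_n | P i] &, injective (fun i : 'I_n => f i)}.
  by move=> i j Pi Pj /(finj _ _ Pi Pj) /val_inj.
by rewrite -(card_in_imset inj) max_card.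
Qed.

(** Together with count_small_value, this counts the Q that the sieve misses. *)
Lemma count_small_ppow (z e : nat) : (T < 2 ^ e)%N ->
  \sum_(0 <= Q < T.+1 | (size (primes Q) == 1%N) && all (fun q => q <= z)%N (primes Q)) 1
  <= (z.+1 * e.+1)%:R :> R.
Proof.
move=> Te; rewrite big_mkord.
pose P (Q : nat) := [&& (Q <= T)%N, size (primes Q) == 1%N & all (fun q => q <= z)%N (primes Q)].
pose f (Q : nat) : 'I_z.+1 * 'I_e.+1 :=
  (inord (head 0 (primes Q)), inord (logn (head 0 (primes Q)) Q)).
rewrite (eq_bigl (fun Q : 'I_T.+1 => P Q)); last by move=> Q; rewrite /P -ltnS ltn_ord.
rewrite -(big_mkord P (fun=> 1)).
apply: le_trans (@count_inj_le T.+1 P _ f _) _; last by rewrite card_prod !card_ord.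
have lem Q : P Q -> exists q, [/\ prime q, primes Q = [:: q],
    (q <= z)%N, (logn q Q <= e)%N & Q = (q ^ logn q Q)%N].
  case/and3P => QT /eqP/primes1P[q [pq E e0 QE]]; rewrite E /= andbT => qz.
  exists q; split=> //; rewrite -ltnS; apply: leq_trans (leqnSn _).
  rewrite -(ltn_exp2l _ _ (ltnSn 1)); apply: leq_ltn_trans Te; apply: leq_trans QT.
  by rewrite {2}QE leq_exp2r // prime_gt1.
move=> Q Q' /lem[q [pq E qz ez QE]] /lem[q' [pq' E' qz' ez' QE']].
rewrite /f E E' /= => /(congr1 (fun x => (val x.1, val x.2))) /=.
rewrite !inordK ?ltnS // => -[qq ee].
by rewrite QE QE' ee qq.
Qed.

Lemma count_small_value (z : nat) :
  \sum_(0 <= Q < T.+1 | (0 <= A%:Z * Q%:Z - a) && (`|(A%:Z * Q%:Z - a)%R| <= z)%N) 1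
  <= (z.+1)%:R :> R.
Proof.
apply: le_trans (@count_inj_le T.+1 _ _ (fun Q => inord `|(A%:Z * Q%:Z - a)%R|%N : 'I_z.+1) _) _;
  last by rewrite card_ord.
move=> Q Q' /= /andP[g0 gz] /andP[g0' gz'] /(congr1 val) /=.
rewrite !inordK ?ltnS // => /(congr1 Posz); rewrite !gez0_abs //.
have A1 : A%:Z != 0 by rewrite eqz_nat -lt0n.
by move/addIr/(mulfI A1) => -[].
Qed.

End PrimePair.

(** The quality (ln T)^2 comes from the harmonic sum squared in
    sieve_mass_lower, with D = A |a|. *)
Theorem prime_pair_bound (R : realType) (A : nat) (a : int) (T : nat) :
  (0 < A)%N -> a != 0 -> (2 %| A * `|a|)%N -> (2 <= T)%N ->
  \sum_(1 <= Q < T.+1 | prime_pair A a Q) 1 <=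
  100 ^+ 2 * rho R (A * `|a|) * (T%:R / ln T%:R ^+ 2) :> R.
Proof.
move=> A0 a0 D2 T2.
have D0 : (0 < A * `|a|)%N by rewrite muln_gt0 A0 absz_gt0.
(* The sieve level is z = y^2 with y about T^(1/16): then z^6 = y^12, which is
   far below T / (ln T)^2, while ln y is still at least ln T / 16 or so. *)
have [y yT Ty] : exists2 y, (y ^ 16 <= T)%N & (T < y.+1 ^ 16)%N.
  have ex : exists y, (y ^ 16 <= T)%N by exists 0%N.
  have bd y : (y ^ 16 <= T)%N -> (y <= T)%N.
    by move=> h; apply: leq_trans h; case: y => // y; exact: (@leq_pexp2l y.+1 1 16).
  exists (ex_maxn ex bd); case: ex_maxnP => m // _ mmax.
  by rewrite ltnNge; apply/negP => /mmax; rewrite ltnn.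
have y0 : (0 < y)%N.
  by case: y yT Ty => // _; rewrite exp1n; lia.
set z := (y * y)%N; have z0 : (0 < z)%N by rewrite muln_gt0 y0.
have cOm p : prime p -> (p <= z)%N ->
    #|pair_classes A a p| = if (p %| A * `|a|)%N then 1%N else 2.
  by move=> pp _; exact: card_pair_classes.
have Omlt p : prime p -> (p <= z)%N -> (#|pair_classes A a p| < p)%N.
  move=> pp pz; rewrite cOm //; case: ifP => pD; first exact: prime_gt1.
  by rewrite ltn_neqAle prime_gt1 // andbT; apply: contraFneq pD => <-.
have main := sieve_mass_lower R (leqnn z) D0 D2 cOm.
have sel := selberg_sieve R Omlt T.+1 z0.
have G1 := sieve_mass_ge1 R Omlt z0.
have T16 : (T < 2 ^ (16 * y))%N.
  apply: leq_trans Ty _; rewrite mulnC expnM leq_exp2r //.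
  exact: ltn_expl.
have cB := count_small_ppow R z T16.
have cC := count_small_value R a T A0 z.
set G := sieve_mass _ _ _ in main sel G1.
set rh := rho R _ in main *.
have rh1 : 1 <= rh by exact: rho_ge1.
set B := \sum_(0 <= Q < T.+1 | _ && all _ _) 1 in cB.
set C := \sum_(0 <= Q < T.+1 | _ && _) 1 in cC.
set Si := \sum_(0 <= Q < T.+1 | _) 1 in sel.
have split : \sum_(1 <= Q < T.+1 | prime_pair A a Q) 1 <= Si + B + C :> R.
  rewrite (@big_nat_widenl _ _ _ 1 0) //= /Si /B /C.
  rewrite [leLHS]big_mkcond [in leRHS]big_mkcond /=.
  rewrite [X in _ + X + _]big_mkcond [X in _ + X]big_mkcond -!big_split /=.
  apply: ler_sum => Q _; case: ifP => [/andP[PQ _]|_]; last by do 3 case: ifP => _; lra.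
  case: (ifP (sifted _ _ _)) => [_|/negP ns]; first by do 2 case: ifP => _; lra.
  case: ifP => [_|/negP nB]; first by case: ifP => _; lra.
  case: ifP => [_|/negP nC]; first lra.
  exfalso; apply: ns; case/and3P: (PQ) => s1 ge0 _.
  apply: prime_pair_sifted => //.
    move=> q E; rewrite ltnNge; apply/negP => qz; apply: nB.
    by rewrite s1 E /= qz.
  by rewrite ltnNge; apply/negP => vz; apply: nC; rewrite ge0.
apply: le_trans split _.
(* Everything is compared with T / L^2, using L <= 16 l <= 16 y and y^16 <= T. *)
have c16 : 0 <= 16 ^+ 2 :> R by exact: sqr_ge0.
set L := ln T%:R; pose l : R := ln y.+1%:R.
have Ly : L <= 16 * l.
  rewrite -[16 * l]/(16%:R * l) mulr_natl -lnXn ?ltr0Sn // ler_ln ?posrE ?exprn_gt0 ?ltr0n //.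
    by rewrite -natrX ler_nat ltnW.
  exact: leq_trans T2.
have L0 : 0 < L by rewrite ln_gt0 // (ltr_nat R 1).
have l0 : 0 < l by lra.
have ly : l <= y%:R.
  rewrite /l -natr1 addrC; apply: le_ln1Dx.
  by apply: lt_le_trans (ler0n _ _); rewrite ltrN10.
have y1 : 1 <= y%:R :> R by rewrite ler1n.
have yTR : y%:R ^+ 16 <= T%:R :> R by rewrite -natrX ler_nat.
have T1 : 1 <= T%:R :> R by rewrite ler1n ltnW.
have {main} main : l ^+ 2 <= rh * G.
  have hl : l <= _ := ln_le_harmonic R y.
  by apply: le_trans main; rewrite !expr2 ler_pM // ltW.
have b1 : T.+1%:R / G <= 2 * 16 ^+ 2 * rh * (T%:R / L ^+ 2).
  have G0 : 0 < G by lra.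
  rewrite mulrA ler_pdivlMr ?exprn_gt0 // mulrAC ler_pdivrMr //.
  have h1 : L ^+ 2 <= 16 ^+ 2 * (rh * G).
    apply: (@le_trans _ _ ((16 * l) ^+ 2)); last by rewrite exprMn; lra.
    by rewrite ler_pXn2r ?nnegrE //; lra.
  apply: (@le_trans _ _ ((2 * T%:R) * (16 ^+ 2 * (rh * G)))); last by lra.
  have h2 : T.+1%:R <= 2 * T%:R :> R by rewrite -natr1; lra.
  by apply: ler_pM => //; rewrite exprn_ge0 // ltW.
have b2 : y%:R ^+ 12 <= 16 ^+ 2 * (T%:R / L ^+ 2).
  rewrite mulrA ler_pdivlMr ?exprn_gt0 //.
  apply: (@le_trans _ _ (y%:R ^+ 12 * (16 * y%:R) ^+ 2)).
    rewrite ler_wpM2l ?exprn_ge0 // ler_pXn2r ?nnegrE //; lra.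
  have -> : y%:R ^+ 12 * (16 * y%:R) ^+ 2 = 16 ^+ 2 * y%:R ^+ 14 :> R by ring.
  rewrite ler_wpM2l //; apply: le_trans yTR; exact: ler_weXn2l.
have b3 : B + C <= 36 * y%:R ^+ 12.
  have z1 : z.+1%:R <= 2 * y%:R ^+ 2 :> R.
    rewrite -natr1 natrM -expr2; have : 1 <= y%:R ^+ 2 :> R by exact: exprn_ege1.
    lra.
  have c1 : C <= 2 * y%:R ^+ 12.
    apply: (le_trans cC); apply: (le_trans z1); rewrite ler_wpM2l //.
    exact: ler_weXn2l.
  have c2 : B <= 34 * y%:R ^+ 12.
    apply: (le_trans cB); rewrite natrM.
    apply: (@le_trans _ _ ((2 * y%:R ^+ 2) * (17 * y%:R))).
      have h3 : (16 * y).+1%:R <= 17 * y%:R :> R by rewrite -natr1 natrM; lra.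
      exact: ler_pM.
    have -> : (2 * y%:R ^+ 2) * (17 * y%:R) = 34 * y%:R ^+ 3 :> R by ring.
    by rewrite ler_wpM2l //; exact: ler_weXn2l.
  lra.
have b4 : z%:R ^+ 6 = y%:R ^+ 12 :> R by rewrite natrM; ring.
set W := T%:R / L ^+ 2 in b1 b2 *.
have W0 : 0 <= W by rewrite divr_ge0 ?exprn_ge0 ?ltW //; lra.
have : W <= rh * W by rewrite ler_peMl.
move: sel; rewrite b4; lra.
Qed.

(** * Elementary prime number estimates *)

Lemma fact_le_expn n : (n`! <= n ^ n)%N.
Proof.
elim: n => // n IH; rewrite factS expnS leq_mul2l /=.
by apply: leq_trans IH _; case: n => // n; rewrite leq_exp2r.
Qed.

Lemma prime_dvd_fact p n : prime p -> (p %| n`!)%N -> (p <= n)%N.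
Proof.
move=> pp; elim: n => [|n IH]; first by rewrite fact0 dvdn1; case: p pp => [|[]].
rewrite factS Euclid_dvdM // => /orP[/dvdn_leq->//|/IH]; exact: leqW.
Qed.

Lemma prod_primes_logn (m : nat) : (0 < m)%N ->
  m = (\prod_(p <- primes m) p ^ logn p m)%N.
Proof.
by move=> m0; rewrite {1}(prod_prime_decomp m0) prime_decompE big_map.
Qed.

Lemma ln_primes_logn (R : realType) (m : nat) : (0 < m)%N ->
  ln m%:R = \sum_(p <- primes m) (logn p m)%:R * ln p%:R :> R.
Proof.
move=> m0; rewrite {1}(prod_primes_logn m0) natr_prod.
have ih : forall l, all prime l -> 0 < \prod_(p <- l) (p ^ logn p m)%:R :> R /\
    ln (\prod_(p <- l) (p ^ logn p m)%:R) = \sum_(p <- l) (logn p m)%:R * ln p%:R :> R.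
  elim=> [|p l IH] /=; first by rewrite !big_nil ln1.
  move=> /andP[/prime_gt0 p0 /IH[h e]].
  have pp : 0 < (p ^ logn p m)%:R :> R by rewrite ltr0n expn_gt0 p0.
  rewrite !big_cons mulr_gt0 // lnM ?posrE // e natrX lnXn ?ltr0n //.
  by rewrite mulr_natl.
by case: (ih (primes m)) => //; apply/allP => p; rewrite mem_primes => /andP[].
Qed.

Lemma big_primes_upto (R : nmodType) (F : nat -> R) (m n : nat) : (0 < m)%N ->
  (forall p, prime p -> (p %| m)%N -> (p <= n)%N) ->
  (forall p, prime p -> ~~ (p %| m)%N -> F p = 0) ->
  \sum_(0 <= p < n.+1 | prime p) F p = \sum_(p <- primes m) F p.
Proof.
move=> m0 mn F0; rewrite (bigID (fun p => p %| m)%N) /= [X in _ + X]big1 ?addr0; last first.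
  by move=> p /andP[]; exact: F0.
rewrite -big_filter; apply: perm_big; apply: uniq_perm;
  rewrite ?filter_uniq ?primes_uniq ?iota_uniq //.
move=> p; rewrite mem_filter mem_primes mem_index_iota m0 ltnS /=.
case pp : (prime p) => //=; case pm : (p %| m)%N => //=.
exact: mn.
Qed.

(** Each prime p <= n divides n! at least n %/ p >= n / (2p) times, and
    ln (n!) <= n ln n. *)
Lemma sum_ln_primes_le (R : realType) (n : nat) : (0 < n)%N ->
  \sum_(0 <= p < n.+1 | prime p) ln p%:R / p%:R <= 2 * ln n%:R :> R.
Proof.
move=> n0.
have n0R : 0 < n%:R :> R by rewrite ltr0n.
rewrite -(ler_pM2l n0R) mulr_sumr.
apply: (@le_trans _ _ (2 * ln (n`!)%:R)); last first.
  rewrite mulrCA ler_wpM2l // mulr_natl -lnXn // ler_ln ?posrE ?exprn_gt0 ?ltr0n ?fact_gt0 //.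
  by rewrite -natrX ler_nat fact_le_expn.
rewrite ln_primes_logn ?fact_gt0 //.
rewrite -(@big_primes_upto _ _ _ n) ?fact_gt0 //; first last.
- by move=> p pp pn; rewrite lognE pp fact_gt0 (negbTE pn) mul0r.
- by move=> p; exact: prime_dvd_fact.
rewrite mulr_sumr.
rewrite big_nat_cond [leRHS]big_nat_cond; apply: ler_sum => p /andP[/andP[_ pn] pp].
have p0 : 0 < p%:R :> R by rewrite ltr0n prime_gt0.
have lnp : 0 <= ln p%:R :> R by rewrite ln_ge0 // ler1n prime_gt0.
rewrite mulrCA [leRHS]mulrA [leRHS]mulrC ler_wpM2l // ler_pdivrMr //.
rewrite -!natrM ler_nat.
apply: (@leq_trans (2 * (n %/ p) * p)%N).
  have := divn_eq n p; have := ltn_pmod n (prime_gt0 pp).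
  have : (0 < n %/ p)%N by rewrite divn_gt0 ?prime_gt0 // -ltnS.
  nia.
rewrite leq_mul2r; apply/orP; right; rewrite leq_mul2l /= logn_fact //.
rewrite big_ltn ?ltnS // expn1 leq_addr //.
Qed.

Lemma exp_le_central_bin n : (2 ^ n <= 'C(n.*2, n))%N.
Proof.
elim: n => // n IH; rewrite doubleS binS expnS mul2n -addnn.
have h : ('C(n.*2, n) <= 'C(n.*2.+1, n.+1))%N by rewrite binS leq_addl.
apply: leq_add; first exact: leq_trans IH h.
apply: leq_trans IH _; apply: leq_trans h _.
rewrite -bin_sub; last by rewrite ltnS -addnn leq_addr.
by rewrite subSS -addnn addnK.
Qed.

(** By Legendre's formula the exponent of p is a sum over k of terms that are
    at most 1, and that vanish as soon as p^k > 2n. *)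
Lemma logn_central_bin p n : prime p -> (0 < n)%N ->
  (p ^ logn p 'C(n.*2, n) <= n.*2)%N.
Proof.
move=> pp n0; have p1 := prime_gt1 pp.
have n20 : (0 < n.*2)%N by rewrite double_gt0.
set e := trunc_log p n.*2.
suff le_e : (logn p 'C(n.*2, n) <= e)%N.
  by apply: leq_trans (trunc_logP p1 n20); rewrite leq_exp2l.
have bf : ('C(n.*2, n) * (n`! * n`!) = n.*2`!)%N.
  by rewrite -(@bin_fact n.*2 n) -addnn ?leq_addr // addnK.
have := congr1 (logn p) bf.
rewrite !lognM ?muln_gt0 ?fact_gt0 ?bin_gt0 -?addnn ?leq_addr // addnn => le.
suff : (logn p n.*2`! <= e + (logn p n`! + logn p n`!))%N by rewrite -le leq_add2r.
rewrite !logn_fact //.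
have -> : (\sum_(1 <= k < n.+1) n %/ p ^ k = \sum_(1 <= k < n.*2.+1) n %/ p ^ k)%N.
  rewrite [RHS](@big_cat_nat _ _ _ n.+1) //=; last by rewrite ltnS -addnn leq_addr.
  rewrite [X in (_ + X)%N]big_nat_cond [X in (_ + X)%N]big1 ?addn0 // => k /andP[/andP[nk _] _].
  by apply: divn_small; apply: leq_trans nk _; apply/ltnW/ltn_expl.
apply: (@leq_trans (\sum_(1 <= k < n.*2.+1) ((k <= e) + (n %/ p ^ k + n %/ p ^ k)))%N).
  apply: leq_sum => k _.
  case: (leqP k e) => [ke|ek]; last first.
    rewrite divn_small //.
    by apply: leq_trans (trunc_log_ltn n.*2 p1) _; rewrite leq_exp2l.
  have pk : (0 < p ^ k)%N by rewrite expn_gt0 prime_gt0.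
  move: (p ^ k)%N pk => P pk; rewrite addnn.
  have e1 := divn_eq n P; have l1 := ltn_pmod n pk.
  have e2 := divn_eq n.*2 P; have l2 := ltn_pmod n.*2 pk.
  move: (n %/ P)%N (n %% P)%N (n.*2 %/ P)%N (n.*2 %% P)%N e1 l1 e2 l2.
  move=> q r q' r' e1 l1 e2 l2; rewrite e1 in e2; nia.
rewrite !big_split /= leq_add2r.
have -> : (\sum_(1 <= k < n.*2.+1) (k <= e) = \sum_(1 <= k < n.*2.+1 | k <= e) 1)%N.
  by rewrite [RHS]big_mkcond; apply: eq_bigr => k _; case: (k <= e)%N.
apply: (@leq_trans (\sum_(1 <= k < e.+1) 1)%N); last by rewrite sum_nat_const_nat muln1 subSS subn0.
case: (leqP n.*2 e) => h.
  rewrite (big_nat_widen _ _ e.+1) ?ltnS // big_mkcond /=.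
  by apply: leq_sum => k _; case: ifP.
rewrite [leqRHS](big_nat_widen _ _ n.*2.+1) ?ltnS ?(ltnW h) //.
Qed.

Lemma central_bin_le n : (0 < n)%N ->
  exists2 s : seq nat, uniq s /\ (forall p, p \in s -> prime p /\ (p <= n.*2)%N)
    & ('C(n.*2, n) <= n.*2 ^ size s)%N.
Proof.
move=> n0; have C0 : (0 < 'C(n.*2, n))%N by rewrite bin_gt0 -addnn leq_addr.
exists (primes 'C(n.*2, n)).
  split; first exact: primes_uniq.
  move=> p; rewrite mem_primes => /and3P[pp _ pC]; split=> //.
  apply: leq_trans (logn_central_bin pp n0).
  by rewrite -{1}(expn1 p) leq_exp2l ?prime_gt1 // logn_gt0 mem_primes pp C0.
rewrite {1}(prod_primes_logn C0).
elim: (primes _) => [|p l IH]; first by rewrite big_nil.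
rewrite big_cons expnS leq_mul //; case pp : (prime p); first exact: logn_central_bin.
by rewrite lognE pp expn0 double_gt0.
Qed.

(** With n = N / 2 the central binomial coefficient is at least 2^n, and it is a
    product of at most pi(x) prime powers, each at most N. *)
Lemma prime_pi_lower (R : realType) (x : R) : 2 <= x ->
  2 / 9 * ln 2 * x <= (prime_pi x)%:R * ln x.
Proof.
move=> x2.
have x0 : 0 <= x by lra.
have /andP[Nx xN] := truncn_itv x0.
set N := Num.truncn x in Nx xN *.
have N2 : (2 <= N)%N by rewrite /N truncn_ge_nat.
have n0 : (0 < N./2)%N by rewrite half_gt0.
have [s [us sP] Cs] := central_bin_le n0.
have nN : (N./2.*2 <= N)%N by rewrite -{2}(odd_double_half N) leq_addl.
have ss : (size s <= prime_pi x)%N.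
  apply: uniq_leq_size => // p /sP[pp pn].
  rewrite mem_primes_upto pp /=; apply: le_trans Nx.
  by rewrite ler_nat (leq_trans pn).
have h : (2 ^ N./2 <= N ^ prime_pi x)%N.
  apply: leq_trans (exp_le_central_bin _) _; apply: (leq_trans Cs).
  apply: (@leq_trans (N ^ size s)); last by rewrite leq_exp2l.
  case: (size s) => // k; by rewrite leq_exp2r.
have N0 : 0 < N%:R :> R by rewrite ltr0n; lia.
have {h} h : (N./2)%:R * ln 2 <= (prime_pi x)%:R * ln x :> R.
  apply: (@le_trans _ _ ((prime_pi x)%:R * ln N%:R)).
    rewrite !mulr_natl -!lnXn // ler_ln ?posrE ?exprn_gt0 //.
    by rewrite -!natrX ler_nat.
  by rewrite ler_wpM2l // ler_ln ?posrE //; lra.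
apply: le_trans h; have l2 : 0 <= ln 2 :> R by rewrite ln_ge0 // ler1n.
rewrite mulrAC ler_wpM2r //.
have : N.+1%:R <= (N./2 * 9)%:R / 2 :> R.
  rewrite ler_pdivlMr // -natrM ler_nat.
  have := odd_double_half N; case: odd => /=; lia.
rewrite natrM => h1; lra.
Qed.

(** * Sums over sets of primes *)

(** This is (j+1) B^j <= (B+1)^(j+1), two terms of the binomial formula.  It is
    the reason why a bounded number of primes may be dropped from a set for the
    price of a larger additive constant. *)
Lemma exp_fact_shift (R : realFieldType) (B : R) (j : nat) : 0 <= B ->
  B ^+ j / j`!%:R <= (B + 1) ^+ j.+1 / j.+1`!%:R.
Proof.
move=> B0; have h : j.+1%:R * B ^+ j + B ^+ j.+1 <= (B + 1) ^+ j.+1.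
  elim: j => [|j IH]; first by rewrite !expr1 expr0; lra.
  rewrite [leRHS]exprS; have B1 : 0 <= B + 1 by lra.
  apply: le_trans (ler_wpM2l B1 IH).
  have b0 : 0 <= B ^+ j by exact: exprn_ge0.
  have j0 : 0 <= j.+1%:R :> R by [].
  rewrite -[j.+2%:R]natr1 !exprS; move: (j.+1%:R) (B ^+ j) b0 j0 => u v v0 u0.
  by have : 0 <= u * v by [exact: mulr_ge0]; lra.
have f0 : 0 < j`!%:R :> R by rewrite ltr0n fact_gt0.
have s0 : 0 < j.+1%:R :> R by [].
rewrite factS natrM ler_pdivlMr ?mulr_gt0 //.
have -> : B ^+ j / j`!%:R * (j.+1%:R * j`!%:R) = j.+1%:R * B ^+ j.
  by field; rewrite gt_eqF.
by have := exprn_ge0 j.+1 B0; lra.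
Qed.

Lemma max_setD1 (X : nat) (U : {set 'I_X}) (p : 'I_X) : p \in U ->
  (p < \max_(q in U) q)%N -> (\max_(q in U :\ p) q = \max_(q in U) q)%N.
Proof.
move=> pU pm; rewrite [RHS](big_setD1 p) //=; apply/esym/maxn_idPr.
move: pm; rewrite (big_setD1 p) //= leq_max ltnn /=; exact: ltnW.
Qed.

(** The index set stands for the integers below X; the weight H will vanish
    outside the primes of E.  The last hypothesis is the Mertens-type bound that
    makes ratios of logarithms harmless. *)
Section SubsetSums.
Variables (R : realType) (X : nat) (H : 'I_X -> R) (C : R).
Hypothesis H0 : forall p, 0 <= H p.
Hypothesis C0 : 0 <= C.
Hypothesis HC : forall P : nat,
  \sum_(p : 'I_X | (p < P)%N) H p * ln (p : nat)%:R <= C * ln P%:R.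

Local Notation I := 'I_X.

Definition set_weight (U : {set I}) : R := \prod_(p in U) H p.

Definition log_max (U : {set I}) : R := ln (\max_(p in U) (p : nat))%N%:R.

(** The largest element is left out: its own ratio is 1, and keeping the maximum
    in the set is what lets the other elements be removed without changing the
    denominator (max_setD1). *)
Definition log_excess (U : {set I}) : R :=
  \sum_(p in U | (p < \max_(q in U) (q : nat))%N) ln (p : nat)%:R / log_max U.

Lemma set_weight_ge0 U : 0 <= set_weight U.
Proof. exact: prodr_ge0. Qed.

Lemma ln_nat_ge0 (n : nat) : 0 <= ln n%:R :> R.
Proof. by case: n => [|n]; [rewrite ln0 | rewrite ln_ge0 // ler1n]. Qed.

Lemma ln_nat_le (m n : nat) : (m <= n)%N -> ln m%:R <= ln n%:R :> R.
Proof.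
case: m => [|m] mn; first by rewrite ln0 // ln_nat_ge0.
by rewrite ler_ln ?posrE ?ltr0n ?ler_nat //; exact: leq_trans mn.
Qed.

Lemma log_ratio_ge0 U (p : nat) : 0 <= ln p%:R / log_max U.
Proof. by rewrite divr_ge0 // ln_nat_ge0. Qed.

Lemma log_excess_ge0 U : 0 <= log_excess U.
Proof. by apply: sumr_ge0 => p _; exact: log_ratio_ge0. Qed.

Lemma log_ratio_le1 (U : {set I}) (p : nat) : (p <= \max_(q in U) q)%N ->
  ln p%:R / log_max U <= 1.
Proof.
move=> pm; have := ln_nat_ge0 (\max_(q in U) q); rewrite -/(log_max U).
rewrite le_eqVlt => /orP[/eqP <-|L0]; first by rewrite invr0 mulr0.
by rewrite ler_pdivrMr // mul1r; exact: ln_nat_le.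
Qed.

Lemma log_excessD1 (U : {set I}) (p : I) : p \in U -> (p < \max_(q in U) q)%N ->
  log_excess U = ln (p : nat)%:R / log_max U + log_excess (U :\ p).
Proof.
move=> pU pm; rewrite /log_excess /log_max max_setD1 //.
rewrite big_mkcondr (big_setD1 p) //= pm; congr (_ + _).
by rewrite [RHS]big_mkcondr.
Qed.

Lemma log_excess_leD1 (U : {set I}) (p : I) : p \in U -> (p < \max_(q in U) q)%N ->
  log_excess U <= 1 + log_excess (U :\ p).
Proof.
move=> pU pm; rewrite (log_excessD1 pU pm) lerD2r; apply: log_ratio_le1.
exact: ltnW.
Qed.

Lemma set_weightD1 (U : {set I}) (p : I) : p \in U -> set_weight U = H p * set_weight (U :\ p).
Proof. by move=> pU; rewrite /set_weight (big_setD1 p). Qed.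

(** A set with a marked element is the same as a set with a marked element
    outside of it. *)
Lemma sum_setD1 (j : nat) (c : {set I} -> I -> R) :
  \sum_(U : {set I} | #|U| == j.+1) \sum_(p in U) c (U :\ p) p =
  \sum_(U : {set I} | #|U| == j) \sum_(p | p \notin U) c U p.
Proof.
rewrite !pair_big_dep /=.
rewrite (reindex_onto (fun x : {set I} * I => (x.2 |: x.1, x.2))
  (fun x : {set I} * I => (x.1 :\ x.2, x.2))) /=; last first.
  by move=> [U p] /= /andP[_ pU]; rewrite setD1K.
apply: eq_big => [[U p]|[U p]] /=.
  rewrite setU11 andbT xpair_eqE eqxx andbT.
  apply/andP/andP => [[cU /eqP e]|[cU pU]].
    have pU : p \notin U by rewrite -e setD11.
    by move: cU; rewrite cardsU1 pU eqSS.
  by rewrite cardsU1 pU eqSS cU setU1K.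
by move=> /andP[_ /eqP[->]].
Qed.

Definition sym_sum (j : nat) : R := \sum_(U : {set I} | #|U| == j) set_weight U.

(** Marking an element of U gives (j+1) e_(j+1) <= (sum H) e_j. *)
Lemma sym_sum_le j : sym_sum j <= (\sum_p H p) ^+ j / j`!%:R.
Proof.
have S0 : 0 <= \sum_p H p by exact: sumr_ge0.
elim: j => [|j IH].
  rewrite /sym_sum (big_pred1 set0); last by move=> U; rewrite cards_eq0.
  by rewrite /set_weight big_set0 expr0 fact0 divr1.
have : j.+1%:R * sym_sum j.+1 <= (\sum_p H p) * sym_sum j.
  have -> : j.+1%:R * sym_sum j.+1 =
      \sum_(U : {set I} | #|U| == j.+1) \sum_(p in U) H p * set_weight (U :\ p).
    rewrite mulr_sumr; apply: eq_bigr => U /eqP cU.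
    rewrite (eq_bigr (fun=> set_weight U)); last by move=> p /set_weightD1 ->.
    by rewrite sumr_const cU mulr_natl.
  rewrite (sum_setD1 j (fun U p => H p * set_weight U)) mulr_sumr.
  apply: ler_sum => U _; rewrite -mulr_suml ler_wpM2r ?set_weight_ge0 //.
  by rewrite [leRHS](bigID (fun p => p \notin U)) /= lerDl sumr_ge0.
have f0 : 0 < j`!%:R :> R by rewrite ltr0n fact_gt0.
move: IH; rewrite factS natrM !ler_pdivlMr ?mulr_gt0 // => IH h.
rewrite mulrA exprS; apply: le_trans (ler_wpM2l S0 IH).
by rewrite [leRHS]mulrA ler_wpM2r ?(ltW f0) // mulrC.
Qed.

(** Expand one factor log_excess U over p in U below the maximum and remove p:
    for the remaining set, with the same maximum P, the sum over p of
    H p * ln p / ln P is at most C.  Used twice, with f = 1 and with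
    f = log_excess, this bounds the first two moments. *)
Lemma log_excess_step (j : nat) (f g : {set I} -> R) :
  (forall (U : {set I}) (p : I), p \in U -> (p < \max_(q in U) q)%N ->
     f U <= g (U :\ p)) ->
  (forall U, 0 <= g U) ->
  \sum_(U : {set I} | #|U| == j.+1) set_weight U * (log_excess U * f U) <=
  C * \sum_(U : {set I} | #|U| == j) set_weight U * g U.
Proof.
move=> fg g0.
pose c (U : {set I}) (p : I) : R := if (p < \max_(q in U) q)%N then
  set_weight U * g U * (H p * ln (p : nat)%:R / log_max U) else 0.
apply: (@le_trans _ _ (\sum_(U : {set I} | #|U| == j.+1) \sum_(p in U) c (U :\ p) p)).
  apply: ler_sum => U _; rewrite /log_excess mulr_suml mulr_sumr.
  rewrite big_mkcondr; apply: ler_sum => p pU; rewrite /c.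
  case: ifP => [pm|_]; last first.
    case: ifP => // _; rewrite !mulr_ge0 ?set_weight_ge0 ?invr_ge0 ?ln_nat_ge0 //.
  rewrite max_setD1 // pm /log_max max_setD1 // -/(log_max U).
  rewrite (set_weightD1 pU).
  have -> : H p * set_weight (U :\ p) * (ln (p : nat)%:R / log_max U * f U) =
    set_weight (U :\ p) * f U * (H p * ln (p : nat)%:R / log_max U) by ring.
  rewrite ler_wpM2r //; first by rewrite -mulrA mulr_ge0 // log_ratio_ge0.
  by rewrite ler_wpM2l ?set_weight_ge0 // fg.
rewrite sum_setD1 mulr_sumr; apply: ler_sum => U _.
have wg : 0 <= set_weight U * g U by rewrite mulr_ge0 ?set_weight_ge0.
rewrite /c -big_mkcondr /= -mulr_sumr [leRHS]mulrC ler_wpM2l //.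
rewrite -mulr_suml.
apply: (@le_trans _ _ ((C * log_max U) / log_max U)).
  rewrite ler_wpM2r ?invr_ge0 ?ln_nat_ge0 //; apply: le_trans (HC _).
  rewrite big_mkcondl; rewrite [leRHS]big_mkcond [leLHS]big_mkcond; apply: ler_sum => p _.
  case: ifP => _ //; case: ifP => _ //; by rewrite mulr_ge0 ?ln_nat_ge0.
rewrite -mulrA; have [->|l0] := eqVneq (log_max U) 0; first by rewrite mul0r mulr0.
by rewrite mulfV // mulr1.
Qed.

(** (4 + Z)^2 <= 32 + 2 Z^2, and the second moment reduces to symmetric sums of
    one or two elements less. *)
Lemma log_excess_sum (j : nat) :
  \sum_(U : {set I} | #|U| == j) set_weight U * (4 + log_excess U) ^+ 2 <=
  (32 + 2 * C + 2 * C ^+ 2) * (((\sum_p H p) + 2) ^+ j / j`!%:R).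
Proof.
set B := \sum_p H p; have B0 : 0 <= B by exact: sumr_ge0.
pose b j (t : R) := t ^+ j / j`!%:R.
have shift i t : 0 <= t -> b i t <= b i.+1 (t + 1) by exact: exp_fact_shift.
have bmono i t u : 0 <= t -> t <= u -> b i t <= b i u.
  move=> t0 tu; rewrite /b ler_wpM2r ?invr_ge0 //.
  by case: i => [|i]; rewrite ?expr0 // ler_pXn2r ?nnegrE //; exact: le_trans tu.
pose S1 i := \sum_(U : {set I} | #|U| == i) set_weight U * log_excess U.
pose S2 i := \sum_(U : {set I} | #|U| == i) set_weight U * log_excess U ^+ 2.
have E0 : log_excess set0 = 0.
  by rewrite /log_excess big1 // => p; rewrite inE.
have S1b i : S1 i <= C * b i (B + 1).
  case: i => [|i].
    rewrite /S1 (big_pred1 set0); last by move=> U; rewrite cards_eq0.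
    by rewrite E0 mulr0 /b expr0 fact0 divr1 mulr1.
  have := @log_excess_step i (fun=> 1) (fun=> 1) (fun _ _ _ _ => lexx _) (fun=> ler01).
  rewrite /S1; under eq_bigr do rewrite mulr1.
  under [in X in _ <= X -> _]eq_bigr do rewrite mulr1.
  move=> h; apply: (le_trans h); rewrite ler_wpM2l //.
  exact: le_trans (sym_sum_le i) (shift _ _ B0).
have S2b i : S2 i <= (C + C ^+ 2) * b i (B + 2).
  case: i => [|i].
    rewrite /S2 (big_pred1 set0); last by move=> U; rewrite cards_eq0.
    rewrite E0 expr0n mulr0 /b expr0 fact0 divr1 mulr1 addr_ge0 // exprn_ge0 //.
  have := @log_excess_step i log_excess (fun U => 1 + log_excess U)
    log_excess_leD1 (fun U => addr_ge0 ler01 (log_excess_ge0 U)).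
  rewrite /S2; under eq_bigr do rewrite -expr2.
  move=> h; apply: (le_trans h).
  have -> : \sum_(U : {set I} | #|U| == i) set_weight U * (1 + log_excess U) =
     sym_sum i + S1 i.
    by rewrite -big_split /=; apply: eq_bigr => U _; rewrite mulrDr mulr1.
  have h1 : sym_sum i <= b i.+1 (B + 2).
    apply: (le_trans (sym_sum_le i)); apply: (le_trans (shift _ _ B0)).
    by apply: bmono; lra.
  have h2 : S1 i <= C * b i.+1 (B + 2).
    apply: (le_trans (S1b i)); rewrite ler_wpM2l //.
    have -> : B + 2 = B + 1 + 1 by ring.
    by apply: shift; lra.
  have -> : (C + C ^+ 2) * b i.+1 (B + 2) = C * (b i.+1 (B + 2) + C * b i.+1 (B + 2)) by ring.
  by rewrite ler_wpM2l // lerD.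
have h0 : sym_sum j <= b j (B + 2).
  by apply: (le_trans (sym_sum_le j)); have := @bmono j B (B + 2) B0; apply; lra.
apply: (@le_trans _ _ (32 * sym_sum j + 2 * S2 j)); last first.
  rewrite -/(b j (B + 2)); have := S2b j; move: h0.
  move: (b j (B + 2)) (sym_sum j) (S2 j) => t u v h1 h2.
  have -> : (32 + 2 * C + 2 * C ^+ 2) * t = 32 * t + 2 * ((C + C ^+ 2) * t) by ring.
  lra.
rewrite !mulr_sumr -big_split /=; apply: ler_sum => U _.
have -> : 32 * set_weight U + 2 * (set_weight U * log_excess U ^+ 2) =
   set_weight U * (32 + 2 * log_excess U ^+ 2) by ring.
rewrite ler_wpM2l ?set_weight_ge0 //.
by have := sqr_ge0 (4 - log_excess U); lra.
Qed.

End SubsetSums.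

(** * Weights of prime powers and of integers *)

Lemma sum_sqr_geom_le (R : realFieldType) (r : R) (J : nat) :
  0 <= r -> r <= 1 / 2 ->
  \sum_(0 <= e < J) e.+1%:R ^+ 2 * r ^+ e <= 1 + 22 * r.
Proof.
move=> r0 r2.
(* The added multiple of r^n is chosen so that the left side does not grow with n:
   c(n) = 2 n^2 + 8 n + 12 satisfies c(n) = (n+1)^2 + c(n+1) / 2. *)
have h n : \sum_(0 <= e < n.+1) e.+1%:R ^+ 2 * r ^+ e +
    (2 * n.+1%:R ^+ 2 + 8 * n.+1%:R + 12) * r ^+ n.+1 <= 1 + 22 * r.
  elim: n => [|n IH]; first by rewrite big_nat1 expr0 expr1; lra.
  rewrite big_nat_recr //=; apply: le_trans IH; rewrite -addrA lerD2l.
  rewrite [r ^+ n.+2]exprS -[n.+2%:R]natr1 mulrA -mulrDl ler_wpM2r ?exprn_ge0 //.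
  have : 0 <= n.+1%:R :> R by []. move: (n.+1%:R) => t t0.
  have : (2 * (t + 1) ^+ 2 + 8 * (t + 1) + 12) * r <=
         (2 * (t + 1) ^+ 2 + 8 * (t + 1) + 12) * (1 / 2).
    by rewrite ler_wpM2l // !addr_ge0 ?mulr_ge0 ?exprn_ge0 //; lra.
  lra.
case: J => [|n]; first by rewrite big_geq //; lra.
apply: le_trans (h n); rewrite lerDl; apply: mulr_ge0; last exact: exprn_ge0.
by rewrite !addr_ge0 ?mulr_ge0 ?exprn_ge0.
Qed.

(** This is e^2 / phi(p^e) for e > 0.  The factor e^2 pays for multiplicities in
    the logarithm: ln m <= (prod of the exponents) * (sum of ln p over p | m). *)
Definition ppow_weight (R : fieldType) (p e : nat) : R :=
  e%:R ^+ 2 / (p%:R ^+ e.-1 * (p%:R - 1)).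

(** An upper bound for the total weight of the powers of p.  The surplus over
    1/p is summable over all p, which is where E(x) + C comes from. *)
Definition prime_weight (R : fieldType) (p : nat) : R :=
  p%:R^-1 + 23 * (p%:R * (p%:R - 1))^-1.

Section Weights.
Variable R : realType.

Lemma ppow_weight_ge0 (p e : nat) : prime p -> 0 <= ppow_weight R p e.
Proof.
move=> pp; have p2 : 2 <= p%:R :> R by rewrite (ler_nat R 2) prime_gt1.
by rewrite divr_ge0 ?exprn_ge0 // mulr_ge0 ?exprn_ge0 //; lra.
Qed.

Lemma prime_weight_ge0 p : prime p -> 0 <= prime_weight R p.
Proof.
move=> pp; have p2 : 2 <= p%:R :> R by rewrite (ler_nat R 2) prime_gt1.
by rewrite addr_ge0 ?invr_ge0 ?mulr_ge0 ?invr_ge0 ?mulr_ge0 //; lra.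
Qed.

Lemma sum_ppow_weight_le p J : prime p ->
  \sum_(1 <= e < J) ppow_weight R p e <= prime_weight R p.
Proof.
move=> pp; have p2 : 2 <= p%:R :> R by rewrite (ler_nat R 2) prime_gt1.
case: J => [|J].
  by rewrite big_geq // prime_weight_ge0.
rewrite big_add1 /=.
have -> : prime_weight R p = (1 + 22 * p%:R^-1) * (p%:R - 1)^-1.
  by rewrite /prime_weight; field; apply/andP; split; lra.
apply: (@le_trans _ _ ((\sum_(0 <= e < J) e.+1%:R ^+ 2 * p%:R^-1 ^+ e) * (p%:R - 1)^-1)).
  rewrite mulr_suml; apply: ler_sum => e _; rewrite /ppow_weight /= invfM exprVn.
  by rewrite mulrA.
have pm : 0 <= (p%:R - 1 : R)^-1 by rewrite invr_ge0; lra.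
rewrite ler_wpM2r //; apply: sum_sqr_geom_le; first by rewrite invr_ge0.
by rewrite div1r lef_pV2 ?posrE //; lra.
Qed.

Lemma prime_weight_le p : prime p -> prime_weight R p <= 24 / p%:R.
Proof.
move=> pp; have p2 : 2 <= p%:R :> R by rewrite (ler_nat R 2) prime_gt1.
have : (p%:R * (p%:R - 1))^-1 <= p%:R^-1 :> R.
  by rewrite lef_pV2 ?posrE ?mulr_gt0 //; nra.
rewrite /prime_weight; lra.
Qed.

Lemma sum_prime_weight_le (Eb : pred nat) (X : nat) :
  \sum_(0 <= p < X | prime p && Eb p) prime_weight R p <=
  \sum_(0 <= p < X | prime p && Eb p) p%:R^-1 + 23.
Proof.
rewrite big_split /= lerD2l -mulr_sumr.
(* Telescoping with 1 / (p (p - 1)) = 1 / (p - 1) - 1 / p. *)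
suff h : \sum_(0 <= p < X | prime p && Eb p) (p%:R * (p%:R - 1))^-1 <= 1 :> R by lra.
have tel n : \sum_(0 <= p < n.+2 | prime p && Eb p) (p%:R * (p%:R - 1))^-1
    <= 1 - n.+1%:R^-1 :> R.
  elim: n => [|n IH].
    rewrite invr1 subrr big1_seq //.
    by move=> p; rewrite mem_index_iota => /andP[/andP[pp _]]; move: (prime_gt1 pp); lia.
  rewrite big_mkcond big_nat_recr //= -big_mkcond.
  have n1 : 0 < n.+1%:R :> R by [].
  have n2 : n.+2%:R = n.+1%:R + 1 :> R by rewrite natr1.
  apply: (@le_trans _ _ (1 - n.+1%:R^-1 + (n.+2%:R * (n.+2%:R - 1))^-1)).
    apply: lerD; first exact: IH.
    case: ifP => _; first exact: lexx.
    by rewrite invr_ge0 n2 mulr_ge0 //; lra.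
  rewrite le_eqVlt; apply/orP; left; apply/eqP; rewrite n2.
  by field; apply/andP; split; lra.
have h : \sum_(0 <= p < X | prime p && Eb p) (p%:R * (p%:R - 1))^-1 <=
  \sum_(0 <= p < X.+2 | prime p && Eb p) (p%:R * (p%:R - 1))^-1 :> R.
  rewrite [leRHS](@big_cat_nat _ _ _ X) //=; last by lia.
  rewrite lerDl; apply: sumr_ge0 => p /andP[pp _].
  have p2 : 2 <= p%:R :> R by rewrite (ler_nat R 2) prime_gt1.
  by rewrite invr_ge0 mulr_ge0 //; lra.
apply: (le_trans h); apply: (le_trans (tel X)).
by rewrite gerBl invr_ge0.
Qed.

Section Fixed.
Variables (Eb : pred nat) (X : nat).

Definition set_prime_weight (p : 'I_X) : R :=
  if prime p && Eb p then prime_weight R p else 0.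

Lemma set_prime_weight_ge0 p : 0 <= set_prime_weight p.
Proof.
by rewrite /set_prime_weight; case: ifP => // /andP[pp _]; exact: prime_weight_ge0.
Qed.

Lemma sum_set_prime_weight :
  \sum_p set_prime_weight p <=
  \sum_(0 <= p < X | prime p && Eb p) p%:R^-1 + 23.
Proof.
apply: le_trans (sum_prime_weight_le Eb X).
by rewrite big_mkord -big_mkcond.
Qed.

Lemma sum_set_prime_weight_ln (P : nat) :
  \sum_(p : 'I_X | (p < P)%N) set_prime_weight p * ln (p : nat)%:R <= 48 * ln P%:R.
Proof.
case: P => [|P]; first by rewrite big_pred0 // ln0 // mulr0.
have -> : 48 * ln P.+1%:R = 24 * (2 * ln P.+1%:R) :> R by ring.
have h := @sum_ln_primes_le R P.+1 isT.
apply: (@le_trans _ _ (24 * \sum_(0 <= p < P.+2 | prime p) ln p%:R / p%:R)); last first.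
  by rewrite ler_wpM2l.
rewrite mulr_sumr.
pose G (p : nat) : R := if prime p then 24 * (ln p%:R / p%:R) else 0.
have G0 p : 0 <= G p.
  by rewrite /G; case: ifP => // _; rewrite mulr_ge0 // divr_ge0 // ln_nat_ge0.
rewrite [leRHS]big_mkcond /=.
rewrite -[leRHS]/(\sum_(0 <= p < P.+2) G p).
apply: (@le_trans _ _ (\sum_(p : 'I_X | (p < P.+1)%N) G p)).
  apply: ler_sum => p _; rewrite /set_prime_weight /G.
  case pp : (prime p) => /=; last by rewrite mul0r.
  have l0 := ln_nat_ge0 R p.
  case: ifP => _; last by rewrite mul0r mulr_ge0 // divr_ge0.
  have := prime_weight_le pp => /(ler_wpM2r l0) /le_trans; apply.
  by rewrite mulrAC -mulrA.
rewrite -(big_mkord (fun p => p < P.+1)%N G) (big_nat_widen _ _ (X + P.+2)) ?leq_addr //.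
rewrite [leRHS](big_nat_widen _ _ (X + P.+2)) ?leq_addl //.
rewrite [leLHS]big_mkcond [leRHS]big_mkcond /=; apply: ler_sum => p _.
case: ifP => [/andP[h1 _]|_]; last by case: ifP.
by rewrite (leq_trans h1).
Qed.

Variable N : nat.

Definition support_set (m : nat) : {set 'I_X} := [set p : 'I_X | (p : nat) \in primes m].

Definition supported (m : nat) : bool :=
  (0 < m)%N && all (fun p => (p < X)%N && Eb p) (primes m).

Definition nat_weight (m : nat) : R :=
  \prod_(p <- primes m) ppow_weight R p (logn p m).

Lemma big_support (S : Type) (idx : S) (op : Monoid.com_law idx) (F : nat -> S) m :
  supported m -> \big[op/idx]_(p <- primes m) F p =
  \big[op/idx]_(p in support_set m) F p.
Proof.
move=> /andP[m0 /allP sm].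
rewrite -[RHS]big_enum -(big_map val xpredT F) /=; apply: perm_big; apply: uniq_perm.
- exact: primes_uniq.
- by rewrite map_inj_uniq ?enum_uniq //; exact: val_inj.
move=> p; apply/idP/mapP => [pm|[q]].
  have /andP[pX _] := sm p pm.
  by exists (Ordinal pX); rewrite ?mem_enum ?inE.
by rewrite mem_enum inE => qm ->.
Qed.

Lemma card_support m : supported m -> #|support_set m| = size (primes m).
Proof.
by move=> sm; rewrite -sum1_card -(big_support _ (fun=> 1%N)) // sum1_size.
Qed.

(** An integer with set of primes V is given by its exponents at V, so the sum
    is at most the product over V of the total weights of prime powers. *)
Lemma fiber_weight_le (V : {set 'I_X}) :
  \sum_(m : 'I_N.+1 | supported m && (support_set m == V)) nat_weight m <=
  set_weight set_prime_weight V.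
Proof.
pose k (m : 'I_N.+1) (p : 'I_X) : 'I_N.+1 := inord (logn p m).
pose Q (p : 'I_X) : pred 'I_N.+1 := fun e => [&& prime p, Eb p & (0 < e)%N].
pose F (p : 'I_X) (e : 'I_N.+1) : R := if prime p then ppow_weight R p e else 0.
have ln_lt (m : 'I_N.+1) p : (logn p m < N.+1)%N.
  case: (posnP m) => [->|m0]; first by rewrite logn0.
  by apply: leq_trans (ltn_ord m); apply: leq_trans (ltn_logl p m0) _.
apply: (@le_trans _ _ (\sum_(m in [set m : 'I_N.+1 | supported m && (support_set m == V)])
    \prod_(p in V) F p (k m p))).
  rewrite le_eqVlt; apply/orP; left; apply/eqP.
  apply: eq_big => [m|m /andP[sm /eqP <-]]; first by rewrite inE.
  rewrite /nat_weight (big_support _ _ sm); apply: eq_bigr => p.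
  by rewrite inE mem_primes /F /k inordK // => /andP[-> _].
apply: (le_trans (@euler_fiber R _ _ _ ord0 _ V k Q F _ _ _)).
- move=> m m'; rewrite !inE => /andP[/andP[m0 sm] /eqP mV] /andP[/andP[m0' sm'] /eqP mV'] e.
  have ordN (n : 'I_N.+1) : (n <= N)%N by rewrite -ltnS.
  apply: val_inj; apply: (eq_logn_ord m0 (ordN m) m0' (ordN m')) => p pp.
  case: (ltnP p X) => [pX|Xp].
    case: (boolP (Ordinal pX \in V)) => [pV|pV].
      by have := e _ pV => /(congr1 val); rewrite /k /= !inordK.
    have nd n (n0 : (0 < n)%N) : support_set n = V -> logn p n = 0%N.
      move=> nV; move: pV; rewrite -nV inE /= => pn.
      by apply/eqP; rewrite eqn0Ngt logn_gt0.
    by rewrite !nd.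
  have nd n (n0 : (0 < n)%N) : all (fun p => (p < X)%N && Eb p) (primes n) -> logn p n = 0%N.
    move=> /allP sn; apply/eqP; rewrite eqn0Ngt logn_gt0; apply/negP => /sn.
    by rewrite ltnNge Xp.
  by rewrite !nd.
- move=> m p; rewrite inE => /andP[/andP[m0 /allP sm] /eqP <-]; rewrite inE => pm.
  rewrite /Q /k inordK // logn_gt0 pm; have /andP[_ ->] := sm _ pm.
  by move: pm; rewrite mem_primes => /andP[->].
- by move=> p e; rewrite /F; case: ifP => // pp; exact: ppow_weight_ge0.
apply: ler_prod => p _; apply/andP; split.
  by apply: sumr_ge0 => e _; rewrite /F; case: ifP => // pp; exact: ppow_weight_ge0.
rewrite /set_prime_weight /Q /F; case pp : (prime p); last by rewrite big_pred0.
case: (Eb p) => /=; last by rewrite big_pred0.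
apply: le_trans (sum_ppow_weight_le N.+1 pp).
by rewrite (@big_nat_widenl _ _ _ 1 0) // big_mkord.
Qed.

(** log_excess_sum with C = 48 = 24 * 2: prime_weight p <= 24 / p, and the sum of
    ln p / p over p <= P is at most 2 ln P.  The additive constant is 23 + 2. *)
Lemma sum_nat_weight (j : nat) :
  \sum_(m : 'I_N.+1 | supported m && (size (primes m) == j))
     nat_weight m * (4 + log_excess R (support_set m)) ^+ 2 <=
  100 ^+ 2 * ((\sum_(0 <= p < X | prime p && Eb p) p%:R^-1 + 25) ^+ j / j`!%:R).
Proof.
have C0 : 0 <= 48 :> R by [].
have c100 : 0 <= 100 ^+ 2 :> R by exact: sqr_ge0.
have h := log_excess_sum set_prime_weight_ge0 C0 sum_set_prime_weight_ln j.
set B := \sum_p _ in h.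
have B0 : 0 <= B by apply: sumr_ge0 => p _; exact: set_prime_weight_ge0.
have Ble := sum_set_prime_weight; rewrite -/B in Ble.
set E := \sum_(0 <= p < X | _) _ in Ble *.
apply: (@le_trans _ _ (100 ^+ 2 * ((B + 2) ^+ j / j`!%:R))); last first.
  rewrite ler_wpM2l // ler_wpM2r ?invr_ge0 //.
  by case: j {h} => [|j]; rewrite ?expr0 // ler_pXn2r ?nnegrE //; lra.
apply: le_trans (le_trans h _); last first.
  have b0 : 0 <= (B + 2) ^+ j / j`!%:R by rewrite divr_ge0 // exprn_ge0 //; lra.
  by rewrite ler_wpM2r //; lra.
rewrite (partition_big (fun m : 'I_N.+1 => support_set m) (fun V => #|V| == j)) /=; last first.
  by move=> m /andP[sm /eqP <-]; rewrite card_support.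
apply: ler_sum => V /eqP Vj.
apply: (@le_trans _ _ (\sum_(m : 'I_N.+1 | supported m && (support_set m == V))
    nat_weight m * (4 + log_excess R V) ^+ 2)).
  rewrite le_eqVlt; apply/orP; left; apply/eqP.
  apply: eq_big => [m|m /andP[_ /eqP -> //]].
  case sm : (supported m) => //=.
  case: (eqVneq (support_set m) V) => [e|]; rewrite ?andbF ?andbT //.
  by rewrite -card_support // e Vj eqxx.
by rewrite -mulr_suml ler_wpM2r ?sqr_ge0 // fiber_weight_le.
Qed.

End Fixed.
End Weights.

(** * Splitting off the largest prime *)

Lemma bigmax_seq_mem (l : seq nat) : l != [::] -> (\max_(r <- l) r)%N \in l.
Proof.
elim: l => // p l IH _; rewrite big_cons inE.
case: (eqVneq l [::]) => [->|l0]; first by rewrite big_nil maxn0 eqxx.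
by rewrite /maxn; case: ifP => _; rewrite ?eqxx // IH ?orbT.
Qed.

Definition max_prime (n : nat) : nat := (\max_(r <- primes n) r)%N.

Lemma max_prime_split (n : nat) : (0 < n)%N -> (0 < size (primes n))%N ->
  let q := max_prime n in
  [/\ (n`_q^' * n`_q = n)%N, primes n`_q = [:: q],
    size (primes n`_q^') = (size (primes n)).-1,
    (forall p, p \in primes n`_q^' -> p \in primes n /\ (p < q)%N) &
    (q <= n`_q)%N].
Proof.
move=> n0 s0 q; have qn : q \in primes n.
  by apply: bigmax_seq_mem; rewrite -size_eq0 -lt0n.
have Q1 : primes n`_q = [:: q].
  by rewrite primes_part -(filter_pred1_uniq (primes_uniq n) qn).
have m1 : primes n`_q^' = rem q (primes n).
  by rewrite primes_part rem_filter ?primes_uniq //.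
split=> //.
- by rewrite mulnC partnC.
- by rewrite m1 size_rem.
- move=> p; rewrite m1 mem_rem_uniq ?primes_uniq // inE => /andP[pq pn]; split=> //.
  by rewrite ltn_neqAle pq /= /q /max_prime leq_bigmax_seq.
- have : q \in primes n`_q by rewrite Q1 inE.
  by rewrite mem_primes => /and3P[_ Q0 /dvdn_leq->].
Qed.

Section Rho.
Variable R : realFieldType.

Lemma rho_mul_le (m n : nat) : (0 < m)%N -> (0 < n)%N ->
  rho R (m * n) <= rho R m * rho R n.
Proof.
move=> m0 n0; rewrite /rho.
have f1 l (P : pred nat) k : {subset l <= primes k} ->
    1 <= \prod_(p <- l | P p) (p%:R / (p%:R - 1)) :> R.
  move=> lk; rewrite big_seq_cond; apply: (big_ind (fun x => 1 <= x)) => //.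
    by move=> y z; exact: mulr_ege1.
  move=> p /andP[/lk pk _]; apply: rho_factor_ge1.
  by move: pk; rewrite mem_primes => /andP[].
rewrite (bigID (fun p => p \in primes m)) /=.
have f0 l P k lk := le_trans ler01 (f1 l P k lk).
have sid k : {subset primes k <= primes k} by move=> ?.
apply: ler_pM; rewrite ?(f0 _ _ _ (sid _)) //.
  rewrite -big_filter le_eqVlt; apply/orP; left; apply/eqP.
  apply: perm_big; apply: uniq_perm; rewrite ?filter_uniq ?primes_uniq // => p.
  by rewrite mem_filter primesM //; case: (p \in primes m).
rewrite [leRHS](bigID (fun p => p \in primes m)) /=.
have -> : \prod_(p <- primes (m * n) | p \notin primes m) (p%:R / (p%:R - 1)) =
   \prod_(p <- primes n | p \notin primes m) (p%:R / (p%:R - 1)) :> R.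
  rewrite -big_filter -[RHS]big_filter; apply: perm_big.
  apply: uniq_perm; rewrite ?filter_uniq ?primes_uniq // => p.
  by rewrite !mem_filter primesM //; case: (p \in primes m).
by rewrite ler_peMl ?(f0 _ _ _ (sid _)) ?(f1 _ _ _ (sid _)).
Qed.

Lemma rho_totient (n : nat) : (0 < n)%N -> rho R n = n%:R / (totient n)%:R.
Proof.
move=> n0; rewrite totientE // {2}(prod_primes_logn n0) !natr_prod -prodf_div /rho.
rewrite !big_seq; apply: eq_bigr => p pn.
have e0 : (0 < logn p n)%N by rewrite logn_gt0.
move: pn; rewrite mem_primes => /and3P[pp _ _].
have p1 : p.-1%:R = p%:R - 1 :> R by rewrite -subn1 natrB ?prime_gt0.
rewrite -{1}(prednK e0) expnS !natrM p1 natrX.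
have p2 : 2 <= p%:R :> R by rewrite (ler_nat R 2) prime_gt1.
field; rewrite expf_neq0; lra.
Qed.

Lemma rho_shift_le (a : int) : rho R (shift_s a) <= 2.
Proof.
rewrite /shift_s /rho; case: ifP => _; first by rewrite (_ : primes 1 = [::]) // big_nil; lra.
by rewrite (_ : primes 2 = [:: 2%N]) // big_seq1 ler_pdivrMr; lra.
Qed.

End Rho.

(** So nat_weight m is 1 / phi(m) times the squared product of the exponents. *)
Lemma nat_weightE (R : realType) (m : nat) : (0 < m)%N ->
  nat_weight R m * m%:R = (\prod_(p <- primes m) (logn p m)%:R) ^+ 2 * rho R m.
Proof.
move=> m0; rewrite /nat_weight {3}(prod_primes_logn m0) natr_prod /rho expr2.
rewrite -!big_split /= !big_seq; apply: eq_bigr => p pm.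
have e0 : (0 < logn p m)%N by rewrite logn_gt0.
move: pm; rewrite mem_primes => /and3P[pp _ _].
have p2 : 2 <= p%:R :> R by rewrite (ler_nat R 2) prime_gt1.
have -> : (p ^ logn p m)%:R = p%:R * p%:R ^+ (logn p m).-1 :> R.
  by rewrite -exprS prednK // natrX.
rewrite /ppow_weight.
field; rewrite expf_neq0; lra.
Qed.

Lemma nat_weight_ge0 (R : realType) (m : nat) : 0 <= nat_weight R m.
Proof.
rewrite /nat_weight big_seq; apply: prodr_ge0 => p.
by rewrite mem_primes => /andP[pp _]; exact: ppow_weight_ge0.
Qed.

Section LogRatio.
Variables (R : realType) (Eb : pred nat) (X : nat).

Lemma sum_ln_support_le (m T : nat) : supported Eb X m -> (2 <= T)%N ->
  (forall p, p \in primes m -> (p <= T)%N) ->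
  \sum_(p <- primes m) ln p%:R <= (1 + log_excess R (support_set X m)) * ln T%:R :> R.
Proof.
move=> sm T2 pT; rewrite (big_support _ _ sm).
set U := support_set X m.
have lT : 0 < ln T%:R :> R by rewrite ln_gt0 // (ltr_nat R 1).
have UT (p : 'I_X) : p \in U -> prime p /\ (p <= T)%N.
  by rewrite inE => pm; split; [move: pm; rewrite mem_primes => /andP[] | exact: pT].
case: (posnP #|U|) => [/eqP|U0].
  rewrite cards_eq0 => /eqP ->; rewrite big_set0 mulr_ge0 ?(ltW lT) //.
  by rewrite addr_ge0 // log_excess_ge0.
have [q qU qmax] := eq_bigmax_cond (fun p : 'I_X => p : nat) U0.
have [qp qT] := UT _ qU.
have lq : 0 < ln (q : nat)%:R :> R by rewrite ln_gt0 // (ltr_nat R 1) prime_gt1.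
rewrite (bigD1 q) //= mulrDl mul1r; apply: lerD; first exact: ln_nat_le.
rewrite /log_excess /log_max qmax.
have -> : \sum_(p in U | (p < q)%N) ln (p : nat)%:R / ln (q : nat)%:R =
   (\sum_(p in U | p != q) ln (p : nat)%:R) / ln (q : nat)%:R :> R.
  rewrite mulr_suml; apply: eq_bigl => p; case pU : (p \in U) => //=.
  by rewrite ltn_neqAle val_eqE -qmax leq_bigmax_cond ?andbT.
rewrite mulrAC -mulrA ler_peMr //.
  by apply: sumr_ge0 => p _; exact: ln_nat_ge0.
by rewrite ler_pdivlMr // mul1r; exact: ln_nat_le.
Qed.

(** From N < s m (T+1) <= m T^3, ln N <= ln m + 3 ln T.  In ln m each prime
    counts with its exponent, at most the product of all of them, and since T is
    at least the largest prime of m, the sum of ln p over p | m is at most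
    (1 + log_excess) ln T. *)
Lemma ln_ratio_le (m T N s : nat) : supported Eb X m -> (2 <= T)%N ->
  (forall p, p \in primes m -> (p <= T)%N) -> (0 < N)%N -> (s <= 2)%N ->
  (N < s * m * T.+1)%N ->
  ln N%:R <= (\prod_(p <- primes m) (logn p m)%:R) *
             (4 + log_excess R (support_set X m)) * ln T%:R :> R.
Proof.
move=> sm T2 pT N0 s2 Ns.
have m0 : (0 < m)%N by case/andP: sm.
set Om := \prod_(p <- _) _.
have OmN : Om = (\prod_(p <- primes m) logn p m)%N%:R by rewrite natr_prod.
have Om1 : 1 <= Om.
  rewrite OmN ler1n big_seq; apply: prodn_cond_gt0 => p; by rewrite logn_gt0.
have lT : 0 < ln T%:R :> R by rewrite ln_gt0 // (ltr_nat R 1).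
set Z := log_excess _ _; have Z0 : 0 <= Z by exact: log_excess_ge0.
have lN : ln N%:R <= ln m%:R + 3 * ln T%:R :> R.
  have -> : ln m%:R + 3 * ln T%:R = ln (m * T ^ 3)%:R :> R.
    have T0 : 0 < T%:R :> R by rewrite ltr0n ltnW.
    by rewrite natrM lnM ?posrE ?ltr0n ?expn_gt0 ?(ltnW T2) // natrX lnXn // mulr_natl.
  apply: ln_nat_le; apply: ltnW; apply: (leq_trans Ns).
  have : (2 * T.+1 <= T ^ 3)%N.
    rewrite !expnS expn0 muln1; have : (4 <= T * T)%N by rewrite (@leq_mul 2 2).
    move: (T * T)%N => t t4; nia.
  move: (T ^ 3)%N => t; nia.
have lm : ln m%:R <= Om * \sum_(p <- primes m) ln p%:R :> R.
  rewrite ln_primes_logn // mulr_sumr big_seq [leRHS]big_seq; apply: ler_sum => p pm.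
  rewrite ler_wpM2r ?ln_nat_ge0 // OmN ler_nat dvdn_leq //.
    by rewrite big_seq; apply: prodn_cond_gt0 => r; rewrite logn_gt0.
  by rewrite (big_rem p) //= dvdn_mulr.
have sl := sum_ln_support_le sm T2 pT; rewrite -/Z in sl.
have : Om * \sum_(p <- primes m) ln p%:R <= Om * ((1 + Z) * ln T%:R).
  by rewrite ler_wpM2l //; lra.
have : 3 * ln T%:R <= Om * (3 * ln T%:R) by rewrite ler_peMl //; lra.
lra.
Qed.

End LogRatio.

(** * The count of shifted primes *)

Lemma shift_s_gt0 a : (0 < shift_s a)%N.
Proof. by rewrite /shift_s; case: ifP. Qed.

Lemma shift_s_le2 a : (shift_s a <= 2)%N.
Proof. by rewrite /shift_s; case: ifP. Qed.

Lemma shift_s_even a : (2 %| shift_s a * `|a|)%N.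
Proof. by rewrite /shift_s; case: ifP => h; rewrite ?mul1n // dvdn_mulr. Qed.

(** prime_pair_bound for A = s m, with (ln T)^2 traded for (ln N)^2 by
    ln_ratio_le and T <= N / m; the factor rho(m) / m joins the squared ratio to
    form nat_weight m. *)
Lemma cofactor_bound (R : realType) (Eb : pred nat) (X : nat) (a : int) (m N : nat) :
  let T := (N %/ (shift_s a * m))%N in
  a != 0 -> supported Eb X m -> (2 <= T)%N ->
  (forall p, p \in primes m -> (p <= T)%N) ->
  \sum_(1 <= Q < T.+1 | prime_pair (shift_s a * m) a Q) 1 <=
  2 * 100 ^+ 2 * rho R `|a| * (N%:R / ln N%:R ^+ 2) *
   (nat_weight R m * (4 + log_excess R (support_set X m)) ^+ 2).
Proof.
move=> T a0 sm T2 pT; have m0 : (0 < m)%N by case/andP: sm.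
have s0 := shift_s_gt0 a.
have sm0 : (0 < shift_s a * m)%N by rewrite muln_gt0 s0.
have aa0 : (0 < `|a|)%N by rewrite absz_gt0.
have D2 : (2 %| shift_s a * m * `|a|)%N by rewrite mulnAC dvdn_mulr // shift_s_even.
have N2 : (2 <= N)%N.
  by apply: leq_trans T2 _; exact: leq_div.
have lr := ln_ratio_le R sm T2 pT (ltnW N2) (shift_s_le2 a).
have {}lr := lr (etrans (congr1 _ (mulnC _ _)) (ltn_ceil N sm0)).
set Om := \prod_(p <- _) _ in lr; set Z := log_excess _ _ in lr *.
have Z0 : 0 <= Z by exact: log_excess_ge0.
have Om0 : 0 <= Om by apply: prodr_ge0.
have lT : 0 < ln T%:R :> R by rewrite ln_gt0 // (ltr_nat R 1).
have lN : 0 < ln N%:R :> R by rewrite ln_gt0 // (ltr_nat R 1).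
have rm : rho R (shift_s a * m * `|a|) <= 2 * rho R m * rho R `|a|.
  apply: le_trans (rho_mul_le R sm0 aa0) _.
  rewrite ler_wpM2r ?(le_trans ler01 (rho_ge1 _ _)) //.
  apply: le_trans (rho_mul_le R s0 m0) _.
  by rewrite ler_wpM2r ?(le_trans ler01 (rho_ge1 _ _)) // rho_shift_le.
have c100 : 0 <= 100 ^+ 2 :> R by exact: sqr_ge0.
have ra0 : 0 <= rho R `|a| by exact: le_trans ler01 (rho_ge1 _ _).
have key : rho R m * (T%:R / ln T%:R ^+ 2) <=
    N%:R / ln N%:R ^+ 2 * (nat_weight R m * (4 + Z) ^+ 2).
  rewrite mulrA ler_pdivrMr ?exprn_gt0 // mulrAC -mulrA mulrAC ler_pdivlMr ?exprn_gt0 //.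
  have l2 : ln N%:R ^+ 2 <= (Om * (4 + Z) * ln T%:R) ^+ 2.
    by rewrite ler_pXn2r ?nnegrE ?(ltW lN) // (le_trans (ltW lN)).
  have rm0 : 0 <= rho R m * T%:R by rewrite mulr_ge0 // (le_trans ler01 (rho_ge1 _ _)).
  apply: le_trans (ler_wpM2l rm0 l2) _.
  have -> : rho R m * T%:R * (Om * (4 + Z) * ln T%:R) ^+ 2 =
     (Om ^+ 2 * rho R m) * (T%:R * ((4 + Z) ^+ 2 * ln T%:R ^+ 2)) by ring.
  rewrite -nat_weightE //.
  have nw0 : 0 <= nat_weight R m by exact: nat_weight_ge0.
  have -> : nat_weight R m * m%:R * (T%:R * ((4 + Z) ^+ 2 * ln T%:R ^+ 2)) =
     (T%:R * m%:R) * (nat_weight R m * (4 + Z) ^+ 2 * ln T%:R ^+ 2) by ring.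
  rewrite [leRHS](_ : _ = N%:R * (nat_weight R m * (4 + Z) ^+ 2 * ln T%:R ^+ 2)); last by ring.
  have c0 : 0 <= nat_weight R m * (4 + Z) ^+ 2 * ln T%:R ^+ 2.
    by rewrite mulr_ge0 ?sqr_ge0 // mulr_ge0 ?sqr_ge0.
  rewrite ler_wpM2r // -natrM ler_nat.
  apply: leq_trans (leq_divM N (shift_s a * m)); rewrite leq_mul2l leq_pmull ?orbT //.
apply: le_trans (prime_pair_bound R sm0 a0 D2 T2) _.
have t0 : 0 <= T%:R / ln T%:R ^+ 2 :> R by rewrite divr_ge0 // sqr_ge0.
apply: (@le_trans _ _ (100 ^+ 2 * (2 * rho R m * rho R `|a|) * (T%:R / ln T%:R ^+ 2))).
  by rewrite ler_wpM2r // ler_wpM2l.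
have -> : 100 ^+ 2 * (2 * rho R m * rho R `|a|) * (T%:R / ln T%:R ^+ 2) =
  2 * 100 ^+ 2 * rho R `|a| * (rho R m * (T%:R / ln T%:R ^+ 2)) by ring.
by rewrite -[leRHS]mulrA ler_wpM2l // !mulr_ge0.
Qed.

Lemma shifted_primeP a (E : set nat) k p : shifted_prime a E k p ->
  let n := shifted_quot a p in
  [/\ prime p, (0 < n)%N, (shift_s a * n)%N%:Z = p%:Z + a,
   (forall q, q \in primes n -> E q) & size (primes n) = k].
Proof.
case=> pp pa dv [n0 nE] om n; split=> //.
  have pa0 : 0 <= p%:Z + a by lia.
  rewrite PoszM /n /shifted_quot gez0_abs; last by rewrite divz_ge0 // ltz_nat shift_s_gt0.
  by rewrite mulrC divzK.
by move=> q; rewrite mem_primes => /and3P[pq _ qn]; exact: nE.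
Qed.

(** The map p |-> (m, Q) with n = m Q and Q the power of the largest prime of n
    is injective since p = s m Q - a.  The bound on N ensures that the primes of
    m are below X even when a > 0. *)
Lemma shifted_prime_count_le (R : realType) (a : int) (E : set nat) (k X N : nat) :
  (0 < k)%N -> (forall p, (p < X)%N -> p%:Z + a <= N%:Z) -> (N < X + X./2)%N ->
  \sum_(0 <= p < X | prime p && `[< shifted_prime a E k p >]) 1 <=
  \sum_(m : 'I_N.+1 | [&& supported (fun p => `[< E p >]) X m,
        size (primes m) == k.-1, (2 <= N %/ (shift_s a * m))%N &
        all (fun p => p <= N %/ (shift_s a * m))%N (primes m)])
    \sum_(1 <= Q < (N %/ (shift_s a * m)).+1 | prime_pair (shift_s a * m) a Q) 1 :> R.
Proof.
move=> k0 bN NX; set s := shift_s a; have s0 : (0 < s)%N by exact: shift_s_gt0.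
pose T m := (N %/ (s * m))%N.
pose good (m : nat) := [&& supported (fun p => `[< E p >]) X m,
        size (primes m) == k.-1, (2 <= T m)%N & all (fun p => p <= T m)%N (primes m)].
pose n (p : nat) := shifted_quot a p.
pose Q p := ((n p)`_(max_prime (n p)))%N.
pose M p := ((n p)`_(max_prime (n p))^')%N.
pose A : {set 'I_X} := [set p : 'I_X | prime p && `[< shifted_prime a E k p >]].
pose B : {set 'I_N.+1 * 'I_N.+1} :=
  [set x : 'I_N.+1 * 'I_N.+1 | good x.1 &&
    [&& (0 < x.2)%N, (x.2 <= T x.1)%N & prime_pair (s * x.1) a x.2]].
have main p : p \in A -> [/\ (M p <= N)%N, (Q p <= N)%N, (0 < Q p)%N, (Q p <= T (M p))%N &
   [/\ good (M p), prime_pair (s * M p) a (Q p) & (s * (M p * Q p))%N%:Z = p%:Z + a]].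
  rewrite inE => /andP[pp /asboolP /shifted_primeP[_ n0 nE En sn]].
  rewrite -/(n p) in n0 nE En sn.
  have kp : (0 < size (primes (n p)))%N by rewrite sn.
  have [MQ Q1 M1 Mq qQ] := max_prime_split n0 kp.
  rewrite -/(M p) -/(Q p) in MQ Q1 M1 Mq qQ.
  set q := max_prime (n p) in Q1 Mq qQ.
  have : q \in primes (Q p) by rewrite Q1 inE.
  rewrite mem_primes => /and3P[pq Q0 qdQ].
  have M0 : (0 < M p)%N by move: n0; rewrite -MQ muln_gt0 => /andP[].
  have eq : (s * (M p * Q p))%N%:Z = p%:Z + a by rewrite MQ.
  have le : (s * (M p * Q p) <= N)%N by rewrite -lez_nat eq bN.
  have QT : (Q p <= T (M p))%N by rewrite /T leq_divRL ?muln_gt0 ?s0 // mulnC -mulnA.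
  have MQN : (M p * Q p <= N)%N by apply: leq_trans le; rewrite leq_pmull.
  have q2 := prime_gt1 pq.
  split=> //; first by apply: leq_trans MQN; rewrite leq_pmulr.
    by apply: leq_trans MQN; rewrite leq_pmull.
  split=> //.
    apply/and4P; split.
    - rewrite /supported M0; apply/allP => r rM; have [rn rq] := Mq r rM.
      apply/andP; split; last by apply/asboolP/En.
      have r2 : (1 < r)%N by move: rn; rewrite mem_primes => /andP[/prime_gt1].
      have rleM : (r <= M p)%N by move: rM; rewrite mem_primes => /and3P[_ _ /dvdn_leq->].
      (* r divides m and Q >= q > r >= 2, so 3 r <= m Q <= N <= 3 X / 2. *)
      have : (r * 3 <= M p * Q p)%N by apply: leq_mul => //; lia.
      by move=> h; have := odd_double_half X; case: odd => /=; lia.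
    - by rewrite M1 sn.
    - exact: leq_trans q2 (leq_trans qQ QT).
    - by apply/allP => r /Mq[_ rq]; apply: leq_trans QT; apply: leq_trans qQ; exact: ltnW.
  rewrite /prime_pair Q1 /= -PoszM -mulnA eq addrK.
  by rewrite pp.
have -> : \sum_(0 <= p < X | prime p && `[< shifted_prime a E k p >]) 1 =
    \sum_(p in A) (1 : R).
  by rewrite big_mkord; apply: eq_bigl => p; rewrite inE.
pose f (p : 'I_X) : 'I_N.+1 * 'I_N.+1 := (inord (M p), inord (Q p)).
apply: (@le_trans _ _ (\sum_(x in B) 1)).
  apply: (@ler_sum_inj R _ _ A B f (fun=> 1)) => //.
    move=> p p' pA pA'; have [h1 h2 _ _ [_ _ h3]] := main p pA.
    have [h1' h2' _ _ [_ _ h3']] := main p' pA'.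
    move=> /(congr1 (fun x => (val x.1, val x.2))) /=.
    rewrite !inordK ?ltnS // => -[eM eQ].
    apply: val_inj => /=; move: h3; rewrite eM eQ h3' => /addIr [] //.
  move=> p pA; have [h1 h2 h4 h5 [h6 h7 h3]] := main p pA.
  by rewrite inE /f /= !inordK ?ltnS // h6 h4 h5.
rewrite le_eqVlt; apply/orP; left; apply/eqP.
transitivity (\sum_(m : 'I_N.+1 | good m)
  \sum_(Q : 'I_N.+1 | [&& (0 < Q)%N, (Q <= T m)%N & prime_pair (s * m) a Q]) (1 : R)).
  by rewrite pair_big_dep; apply: eq_bigl => x; rewrite inE.
apply: eq_bigr => m _.
rewrite [RHS](@big_nat_widenl _ _ _ 1 0) // (big_nat_widen _ _ N.+1); last first.
  by rewrite ltnS leq_div.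
rewrite big_mkord; apply: eq_bigl => r; rewrite ltnS.
by case: (0 < r)%N; case: (r <= _)%N; rewrite ?andbT ?andbF.
Qed.

Local Open Scope classical_set_scope.

Theorem corollary3 (R : realType) :
  exists K C : R, [/\ 0 < K, 0 < C &
    forall (a : int) (E : set nat) (x : R) (k : nat),
      a != 0 ->
      E !=set0 -> (forall p : nat, E p -> prime p) ->
      2 * (`|a|%N)%:R <= x ->
      (0 < k)%N ->
      (shifted_prime_count a E k x)%:R <=
        K * ((`|a|%N)%:R / (totient `|a|%N)%:R) * (prime_pi x)%:R *
        ((recip_prime_sum E x + C) ^+ k.-1 / ((k.-1)`!%:R * ln x))].
Proof.
have l2 : 0 < ln 2 :> R by rewrite ln_gt0 // (ltr_nat R 1).
exists (2 * 100 ^+ 2 * 7 * 100 ^+ 2 / ln 2), 25; split;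
  [by rewrite divr_gt0 ?mulr_gt0 ?exprn_gt0|by []|].
move=> a E x k a0 _ _ ax k0.
have aa0 : (0 < `|a|)%N by rewrite absz_gt0.
have x2 : 2 <= x.
  by apply: le_trans ax; rewrite ler_peMr // ler1n.
have x0 : 0 <= x by lra.
have /andP[N0x xN0] := truncn_itv x0.
have aN0 : (`|a|.*2 <= Num.truncn x)%N.
  by rewrite truncn_ge_nat // -muln2 natrM mulrC.
set N0 := Num.truncn x in N0x xN0 aN0.
pose N := (N0 + `|a|)%N; pose X := N0.+1.
have bN p : (p < X)%N -> p%:Z + a <= N%:Z.
  rewrite ltnS => pN; rewrite /N PoszD; apply: lerD; first by rewrite lez_nat.
  by rewrite abszE ler_norm.
have NX : (N < X + X./2)%N.
  rewrite /N /X; have := odd_double_half N0.+1; case: odd => /=; lia.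
have cnt : (shifted_prime_count a E k x)%:R =
    \sum_(0 <= p < X | prime p && `[< shifted_prime a E k p >]) 1 :> R.
  rewrite /shifted_prime_count /primes_upto -/N0 -sum1_count big_filter_cond.
  by rewrite natr_sum /index_iota subn0.
have rE : recip_prime_sum E x =
    \sum_(0 <= p < X | prime p && `[< E p >]) p%:R^-1 :> R.
  by rewrite /recip_prime_sum /primes_upto -/N0 big_filter_cond /index_iota subn0.
rewrite cnt rE.
apply: le_trans (shifted_prime_count_le R E k0 bN NX) _.
set Ex := \sum_(0 <= p < X | _) _.
have Ex0 : 0 <= Ex by apply: sumr_ge0 => p _; rewrite invr_ge0.
pose Eb p := `[< E p >].
have xN : x <= N%:R.
  apply: ltW; apply: lt_le_trans xN0 _; rewrite ler_nat /N; lia.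
have lx : 0 < ln x by rewrite ln_gt0 //; lra.
have lxN : ln x <= ln N%:R by rewrite ler_ln ?posrE //; lra.
have c100 : 0 <= 100 ^+ 2 :> R by exact: sqr_ge0.
have ra0 : 0 <= rho R `|a| by exact: le_trans ler01 (rho_ge1 _ _).
set NL := N%:R / ln N%:R ^+ 2 : R.
have NL0 : 0 <= NL by rewrite divr_ge0 // sqr_ge0.
set b := (Ex + 25) ^+ k.-1 / k.-1`!%:R : R.
have b0 : 0 <= b by rewrite divr_ge0 // exprn_ge0 //; lra.
have c1 : 0 <= 2 * 100 ^+ 2 * rho R `|a| by apply: mulr_ge0 => //; exact: mulr_ge0.
apply: (@le_trans _ _ (2 * 100 ^+ 2 * rho R `|a| * NL * (100 ^+ 2 * b))).
  apply: le_trans (ler_wpM2l _ (sum_nat_weight R Eb X N k.-1)); last exact: mulr_ge0.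
  rewrite mulr_sumr [leLHS]big_mkcond [leRHS]big_mkcond; apply: ler_sum => m _.
  case: ifP => [/and4P[sm sz T2 pT]|_].
    rewrite sm sz /=; apply: (@cofactor_bound R Eb) => //.
    by move=> p pm; exact: (allP pT).
  case: ifP => // _; apply: mulr_ge0; first exact: mulr_ge0.
  by apply: mulr_ge0; [exact: nat_weight_ge0 | exact: sqr_ge0].
rewrite rho_totient // in ra0 c1 *.
set ra := _ / (totient _)%:R in ra0 c1 *.
set P := (prime_pi x)%:R.
have hpi : 2 / 9 * ln 2 * x <= P * ln x := prime_pi_lower x2.
have hNL : NL <= 7 / ln 2 * (P / ln x).
  have N32 : N%:R <= 3 / 2 * x.
    rewrite /N natrD; have : (`|a|)%:R <= x / 2 by rewrite ler_pdivlMr // mulrC.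
    lra.
  apply: (@le_trans _ _ ((3 / 2 * x) / ln x ^+ 2)).
    apply: ler_pM => //; first by rewrite invr_ge0 sqr_ge0.
    rewrite lef_pV2 ?posrE ?exprn_gt0 ?(lt_le_trans lx) //.
    by rewrite ler_pXn2r ?nnegrE ?(ltW lx) // (le_trans (ltW lx)).
  rewrite ler_pdivrMr ?exprn_gt0 //.
  have -> : 7 / ln 2 * (P / ln x) * ln x ^+ 2 = 7 * (P * ln x) / ln 2.
    by field; rewrite !gt_eqF.
  rewrite ler_pdivlMr //.
  have : 0 <= ln 2 * x by rewrite mulr_ge0 // ltW.
  lra.
have -> : (Ex + 25) ^+ k.-1 / (k.-1`!%:R * ln x) = b / ln x.
  by rewrite invfM mulrA.
have -> : 2 * 100 ^+ 2 * 7 * 100 ^+ 2 / ln 2 * ra * P * (b / ln x) =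
   2 * 100 ^+ 2 * ra * (7 / ln 2 * (P / ln x)) * (100 ^+ 2 * b) by ring.
have cb : 0 <= 100 ^+ 2 * b by exact: mulr_ge0.
by rewrite ler_wpM2r // ler_wpM2l.
Qed.
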